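(* Let $(G,E)$ be a self-similar groupoid action, where $E$ is a finite directed graph with no sources, $G$ is a discrete groupoid with $G^{(0)}=E^0$, and $|uE^1|=p\ge 2$ is constant for $u\in E^0$. Let $\mathcal{H}$ be a Hilbert bundle over $E^0$ such that each fiber $\mathcal{H}_u$, $u\in E^0$, has a $p$-fold similarity $\mathcal{H}_u\to\mathcal{H}_u^p$, and let $\pi:C^*(E)\to\mathcal{L}(\mathcal{H})$ be the representation of the graph algebra associated to the similarity of $\mathcal{H}$. A representation $\rho$ of $G$ on $\mathcal{H}$ is self-similar if and only if $\rho$ and $\pi$ generate a representation of the Cuntz-Pimsner algebra $C^*(G,E)$. Hence self-similar representations of $G$ are precisely restrictions onto $G$ of representations of $C^*(G,E)$.
   Context: Graphs. $E=(E^0,E^1,r,s)$ is a finite directed graph with no sources (every vertex is the range of at least one edge). For $k\ge 2$, $E^k=\{e_1e_2\cdots e_k:e_i\in E^1,\ r(e_{i+1})=s(e_i)\}$, with $r(e_1\cdots e_k)=r(e_1)$ and $s(e_1\cdots e_k)=s(e_k)$; $E^*=\bigcup_{k\ge 0}E^k$ is the set of finite paths, including vertices; $vE^k$ and $vE^*$ denote the sets of such paths with range $v$. Self-similar actions. A partial isomorphism of the forest $T_E$ (the union of rooted trees with vertex set $E^*$ and edges $(\alpha,\alpha e)$ for $\alpha\in E^*$, $e\in E^1$, $s(\alpha)=r(e)$) is a pair $(v,w)\in E^0\times E^0$ together with a bijection $g:vE^*\to wE^*$ which restricts to bijections $vE^k\to wE^k$ for all $k\ge 1$ and satisfies $g(\xi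 e)\in g(\xi)E^1$ for $\xi\in vE^*$ and $e\in E^1$ with $r(e)=s(\xi)$. Under composition these form a discrete groupoid $\mathrm{PIso}(T_E)$ with unit space $E^0$ ($v$ being identified with the identity of $vE^*$); such a $g$ has domain $d(g)=v$ and target $t(g)=w$. For a discrete groupoid $G$ with unit space $G^{(0)}=E^0$ and domain and target maps $d,t$, a self-similar action $(G,E)$ is given by a faithful homomorphism $G\to\mathrm{PIso}(T_E)$, written $\xi\mapsto g\cdot\xi$ for $\xi\in d(g)E^*$, such that for every $g\in G$ and $e\in d(g)E^1$ there is a unique $h\in G$, denoted $g|_e$, with $g\cdot(e\xi)=(g\cdot e)(h\cdot\xi)$ for all $\xi\in s(e)E^*$. Graph algebra. $C^*(E)$ is the graph $C^*$-algebra, the universal $C^*$-algebra generated by mutually orthogonal projections $P_u$, $u\in E^0$, and partial isometries $S_e$, $e\in E^1$, such that $S_e^*S_e=P_{s(e)}$ and $\sum_{r(e)=u}S_eS_e^*=P_u$. Similarities. A $p$-fold similarity of an infinite dimensional Hilbert space $\mathcal{K}$ is an isomorphism $\psi:\mathcal{K}\to\mathcal{K}^p=\mathcal{K}\oplus\cdots\oplus\mathcal{K}$ ($p$ summands). A Hilbert bundle over $E^0$ is a Hilbert space with a decomposition $\mathcal{H}=\bigoplus_{u\in E^0}\mathcal{H}_u$. Given a $p$-fold similarity $\psi:\mathcal{H}_u\to\mathcal{H}_u^p$ for each $u\in E^0$, the associated representation $\pi$ of $C^*(E)$ on $\mathcal{H}$ is the one determined by $\pi(S_{e_j})(\xi)=\psi^{-1}(0,\dots,\xi,\dots,0)$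 with $\xi$ in position $j$, for $e_j\in uE^1=\{e_1,\dots,e_p\}$. In the other direction, the similarities associated with a representation $\pi$ of $C^*(E)$ on $\mathcal{H}$ are given by $\mathcal{H}_u=\pi(P_u)\mathcal{H}$ and $\xi\mapsto(\pi(S_{e_1}^* )(\xi),\dots,\pi(S_{e_p}^* )(\xi))$, viewed as a map $\mathcal{H}_u\to\mathcal{H}_u^p$. Representations of $G$. A representation $\rho$ of $G$ on $\mathcal{H}$ is a representation by partial isometries $\rho(g)$ in $\mathcal{L}(\mathcal{H})$, with $\rho(g)$ carrying the fiber $\mathcal{H}_{d(g)}$ onto $\mathcal{H}_{t(g)}$ and $\rho(gh)=\rho(g)\rho(h)$ for composable $g,h$. When each fiber $\mathcal{H}_u$ has a $p$-fold similarity and $\pi:C^*(E)\to\mathcal{L}(\mathcal{H})$ is the associated representation, $\rho$ is called self-similar if $\rho(g)\pi(S_e)=\pi(S_{g\cdot e})\rho(g|_e)$ (for $g\in G$, $e\in d(g)E^1$). The algebra $C^*(G,E)$. Let $\mathcal{X}(E)=C(E^1)$ be the $C^*$-correspondence over $C(E^0)$ associated to the graph $E$, and regard $C(E^0)=C(G^{(0)})\subseteq C^*(G)$, where $C^*(G)$ is the groupoid $C^*$-algebra. $C^*(G,E)$ is the Cuntz-Pimsner algebra of the $C^*$-correspondence $\mathcal{M}=\mathcal{X}(E)\otimes_{C(E^0)}C^*(G)$ over $C^*(G)$, with the usual right action, inner product $\langle\xi\otimes a,\eta\otimes b\rangle=a^*\langle\xi,\eta\rangle b$, and left action determined by $W_g(i_e\otimes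 a)=i_{g\cdot e}\otimes i_{g|_e}a$ if $d(g)=r(e)$ and $0$ otherwise, where $i_e\in C(E^1)$ and $i_g\in C_c(G)$ are point masses and $a\in C^*(G)$. It can also be constructed from an étale groupoid $\mathcal{G}(G,E)$ attached to $(G,E)$: $C^*(G,E)=C^*(\mathcal{G}(G,E))$. It is generated by $U_g$, $P_v$, $S_e$, the images of $g\in G$, $v\in E^0$, $e\in E^1$, which satisfy: (1) $g\mapsto U_g$ is a representation of $G$ by partial isometries with $U_v=P_v$ for $v\in E^0$; (2) the $S_e$ are partial isometries with $S_e^*S_e=P_{s(e)}$ and $\sum_{r(e)=v}S_eS_e^*=P_v$; (3) $U_gS_e=S_{g\cdot e}U_{g|_e}$ if $d(g)=r(e)$, and $U_gS_e=0$ otherwise; (4) $U_gP_v=P_{g\cdot v}U_g$ if $d(g)=v$ (where $g\cdot v=t(g)$), and $U_gP_v=0$ otherwise. That $\rho$ and $\pi$ generate a representation of $C^*(G,E)$ means that they extend to a representation of $C^*(G,E)$ on $\mathcal{H}$ sending $U_g$ to $\rho(g)$ and $S_e$ to $\pi(S_e)$; the restriction onto $G$ of a representation $\Pi$ of $C^*(G,E)$ is $g\mapsto\Pi(U_g)$.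
   Formalization: The similarity of H_u is taken as H_u → ⊕ H_{s(e)} over e in uE^1, not H_u^p, since S_e must act on H_{s(e)}, so the printed formula is undefined unless s(e)=u. In the last sentence representations are nondegenerate with H_u = range of P_u, and fibers may be finite dimensional. *)

(* Defs.v *)
From HB Require Import structures.
From mathcomp Require Import all_boot all_order all_algebra.
From mathcomp Require Import sesquilinear.
From mathcomp Require Import complex.
From mathcomp Require Import all_classical all_reals all_analysis.

Set Implicit Arguments.
Unset Strict Implicit.
Unset Printing Implicit Defensive.

Import Order.TTheory GRing.Theory Num.Theory.
Import numFieldNormedType.Exports.

Local Open Scope classical_set_scope.
Local Open Scope ring_scope.

Record digraph := Digraph {
  E0 : finType;
  E1 : finType;
  rg : E1 -> E0;
  sr : E1 -> E0 }.

Definition no_sources (E : digraph) := forall v : E0 E, exists e : E1 E, rg e = v.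

(* A path [e1 .. ek] with range v is encoded by its list of edges; the empty
   list, read in v E^*, stands for the vertex v. *)
Fixpoint is_path (E : digraph) (v : E0 E) (xi : seq (E1 E)) : bool :=
  if xi is e :: xi' then (rg e == v) && is_path (sr e) xi' else true.

Definition psrc (E : digraph) (v : E0 E) (xi : seq (E1 E)) : E0 E :=
  last v [seq sr e | e <- xi].

Definition paths (E : digraph) (v : E0 E) : set (seq (E1 E)) :=
  [set xi | is_path v xi].

Definition npaths (E : digraph) (v : E0 E) (k : nat) : set (seq (E1 E)) :=
  [set xi | is_path v xi /\ size xi = k].

(* Only the values of g on v E^* are meaningful. *)
Definition partial_iso (E : digraph) (v w : E0 E)
    (g : seq (E1 E) -> seq (E1 E)) : Prop :=
  [/\ set_bij (paths v) (paths w) g,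
      forall k, (1 <= k)%N -> set_bij (npaths v k) (npaths w k) g &
      forall xi e, is_path v xi -> rg e = psrc v xi ->
        exists f, rg f = psrc w (g xi) /\ g (rcons xi e) = rcons (g xi) f].

(* A discrete groupoid with unit space V; gmul g h is meaningful only when
   gd g = gt h. Classically every type carries a choiceType structure. *)
Record groupoid (V : Type) := Groupoid {
  arrow :> choiceType;
  gd : arrow -> V;
  gt : arrow -> V;
  gid : V -> arrow;
  ginv : arrow -> arrow;
  gmul : arrow -> arrow -> arrow;
  gd_id : forall v, gd (gid v) = v;
  gt_id : forall v, gt (gid v) = v;
  gd_inv : forall g, gd (ginv g) = gt g;
  gt_inv : forall g, gt (ginv g) = gd g;
  gd_mul : forall g h, gd g = gt h -> gd (gmul g h) = gd h;
  gt_mul : forall g h, gd g = gt h -> gt (gmul g h) = gt g;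
  gmulA : forall g h k, gd g = gt h -> gd h = gt k ->
    gmul g (gmul h k) = gmul (gmul g h) k;
  gmul_idl : forall g, gmul (gid (gt g)) g = g;
  gmul_idr : forall g, gmul g (gid (gd g)) = g;
  gmul_invl : forall g, gmul (ginv g) g = gid (gd g);
  gmul_invr : forall g, gmul g (ginv g) = gid (gt g) }.

Arguments gid {V} g _ : rename.

(* h is a restriction of g along e: g.(e xi) = (g.e)(h.xi), where the target
   condition says that the right-hand side is a concatenation of paths. *)
Definition is_restriction (E : digraph) (G : groupoid (E0 E))
    (act : G -> seq (E1 E) -> seq (E1 E)) (g : G) (e : E1 E) (h : G) : Prop :=
  [/\ gd h = sr e,
      gt h = psrc (gt g) (act g [:: e]) &
      forall xi, is_path (sr e) xi ->
        act g (e :: xi) = act g [:: e] ++ act h xi].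

Record self_similar_action (E : digraph) (G : groupoid (E0 E)) :=
    SelfSimilarAction {
  act : G -> seq (E1 E) -> seq (E1 E);
  act_piso : forall g, partial_iso (gd g) (gt g) (act g);
  act_id : forall v xi, is_path v xi -> act (gid G v) xi = xi;
  act_mul : forall g h xi, gd g = gt h -> is_path (gd h) xi ->
    act (gmul g h) xi = act g (act h xi);
  act_faithful : forall g h, gd g = gd h -> gt g = gt h ->
    (forall xi, is_path (gd g) xi -> act g xi = act h xi) -> g = h;
  restr : G -> E1 E -> G;
  restrP : forall g e, rg e = gd g ->
    forall h, is_restriction act g e h <-> h = restr g e }.

(* g.e, for rg e = gd g; then act a g [:: e] is a list of length one. *)
Definition eact (E : digraph) (G : groupoid (E0 E))
    (a : self_similar_action G) (g : G) (e : E1 E) : E1 E :=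
  head e (act a g [:: e]).

Section OperatorAlgebras.
Variable R : realType.
Local Notation C := R[i].

Definition lspan (V : lmodType C) (A : set V) : set V :=
  [set x | exists n (c : 'I_n -> C) (a : 'I_n -> V),
    (forall i, A (a i)) /\ x = \sum_i c i *: a i].

(* hdot is linear in its first argument. *)
Record hilbert := Hilbert {
  hilbert_space :> completeNormedModType C;
  hdot : {dot hilbert_space for Num.conj};
  hilbert_norm : forall x : hilbert_space, `|x| ^+ 2 = hdot x x }.

(* C*-algebras are not assumed to be unital. *)
Record cstaralg := CStarAlg {
  cstar_space :> completeNormedModType C;
  cmul : cstar_space -> cstar_space -> cstar_space;
  cadj : cstar_space -> cstar_space;
  cmulA : associative cmul;
  cmul_linl : forall b, linear (fun a => cmul a b);
  cmul_linr : forall a, linear (cmul a);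
  cadjK : involutive cadj;
  cadj_antilin : forall (k : C) a b,
    cadj (k *: a + b) = k^* *: cadj a + cadj b;
  cadjM : forall a b, cadj (cmul a b) = cmul (cadj b) (cadj a);
  cnormM : forall a b, `|cmul a b| <= `|a| * `|b|;
  cnorm_adj : forall a, `|cmul (cadj a) a| = `|a| ^+ 2 }.

Definition star_hom (A B : cstaralg) (f : A -> B) : Prop :=
  [/\ linear f,
      forall a b, f (cmul a b) = cmul (f a) (f b) &
      forall a, f (cadj a) = cadj (f a)].

(* Right Hilbert A-modules; hip is linear in its second argument. *)
Record hilbert_module (A : cstaralg) := HilbertModule {
  hmod_space :> completeNormedModType C;
  ract : hmod_space -> A -> hmod_space;
  hip : hmod_space -> hmod_space -> A;
  ract_linl : forall a, linear (fun x => ract x a);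
  ract_linr : forall x, linear (ract x);
  ractA : forall x a b, ract x (cmul a b) = ract (ract x a) b;
  hip_lin : forall x, linear (hip x);
  hip_ract : forall x y a, hip x (ract y a) = cmul (hip x y) a;
  hip_sym : forall x y, cadj (hip x y) = hip y x;
  hip_ge0 : forall x, exists b, hip x x = cmul (cadj b) b;
  hip_norm : forall x : hmod_space, `|x| ^+ 2 = `|hip x x| }.

Definition adjoint_pair (A : cstaralg) (M : hilbert_module A)
    (T T' : M -> M) : Prop :=
  forall x y, hip (T x) y = hip x (T' y).

Definition rank_one (A : cstaralg) (M : hilbert_module A) (x y : M) : M -> M :=
  fun z => ract x (hip y z).

(* T is in K(M): an adjointable operator which is an operator norm limit of
   finite sums of rank one operators. *)
Definition compact_op (A : cstaralg) (M : hilbert_module A)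
    (T : M -> M) : Prop :=
  (exists T', adjoint_pair T T') /\
  forall eps : C, 0 < eps -> exists s : seq (M * M),
    forall z, `|T z - \sum_(q <- s) rank_one q.1 q.2 z| <= eps * `|z|.

(* The left action A -> L(M) of a C*-correspondence over A. *)
Definition left_action (A : cstaralg) (M : hilbert_module A)
    (phi : A -> M -> M) : Prop :=
  [/\ forall a, linear (phi a),
      forall x, linear (fun a => phi a x),
      forall a b x, phi (cmul a b) x = phi a (phi b x) &
      forall a, adjoint_pair (phi a) (phi (cadj a))].

Section CuntzPimsner.
Variables (A : cstaralg) (M : hilbert_module A) (phi : A -> M -> M).

Definition toeplitz_rep (B : cstaralg) (sigma : A -> B) (tau : M -> B) : Prop :=
  [/\ star_hom sigma /\ linear tau,
      forall x y, cmul (cadj (tau x)) (tau y) = sigma (hip x y),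
      forall a x, tau (phi a x) = cmul (sigma a) (tau x) &
      forall x a, tau (ract x a) = cmul (tau x) (sigma a)].

(* Psi restricts to the *-homomorphism K(M) -> B sending the rank one operator
   of x and y to tau x (tau y)^*; it is unconstrained outside K(M). *)
Definition compact_extension (B : cstaralg) (tau : M -> B)
    (Psi : (M -> M) -> B) : Prop :=
  [/\ forall (k : C) S T, compact_op S -> compact_op T ->
        Psi (fun x => k *: S x + T x) = k *: Psi S + Psi T,
      forall S T, compact_op S -> compact_op T ->
        Psi (S \o T) = cmul (Psi S) (Psi T),
      forall S T, compact_op S -> compact_op T -> adjoint_pair S T ->
        Psi T = cadj (Psi S) &
      forall x y, Psi (rank_one x y) = cmul (tau x) (cadj (tau y))].

(* Pimsner's convention: covariance is imposed on the whole of phi^-1(K(M)),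
   not only on the part orthogonal to ker phi. *)
Definition covariant_rep (B : cstaralg) (sigma : A -> B) (tau : M -> B) : Prop :=
  toeplitz_rep sigma tau /\
  exists Psi, compact_extension tau Psi /\
    forall a, compact_op (phi a) -> Psi (phi a) = sigma a.

Definition cuntz_pimsner (O : cstaralg) (jA : A -> O) (jM : M -> O) : Prop :=
  covariant_rep jA jM /\
  forall (B : cstaralg) (sigma : A -> B) (tau : M -> B),
    covariant_rep sigma tau ->
    exists! f : O -> B, [/\ star_hom f,
      forall a, f (jA a) = sigma a & forall x, f (jM x) = tau x].

End CuntzPimsner.

Definition graph_relations (E : digraph) (B : cstaralg)
    (P : E0 E -> B) (S : E1 E -> B) : Prop :=
  [/\ forall u, cadj (P u) = P u /\ cmul (P u) (P u) = P u,
      forall u v, u != v -> cmul (P u) (P v) = 0,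
      forall e, cmul (cmul (S e) (cadj (S e))) (S e) = S e,
      forall e, cmul (cadj (S e)) (S e) = P (sr e) &
      forall u, \sum_(e | rg e == u) cmul (S e) (cadj (S e)) = P u].

Record graph_cstar (E : digraph) := GraphCStar {
  gc_alg :> cstaralg;
  gc_P : E0 E -> gc_alg;
  gc_S : E1 E -> gc_alg;
  gc_rel : graph_relations gc_P gc_S;
  gc_universal : forall (B : cstaralg) (P : E0 E -> B) (S : E1 E -> B),
    graph_relations P S ->
    exists! f : gc_alg -> B, [/\ star_hom f,
      forall u, f (gc_P u) = P u & forall e, f (gc_S e) = S e] }.

Section GroupoidAlgebra.
Variables (V : finType) (G : groupoid V).

Definition Cc (f : G -> C) : Prop := finite_set [set g | f g != 0].

Definition convolution (f h : G -> C) : G -> C :=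
  fun g => \sum_(k \in [set k | gt k = gt g]) f k * h (gmul (ginv k) g).

Definition involution (f : G -> C) : G -> C := fun g => (f (ginv g))^*.

(* Phi restricts to a *-homomorphism C_c(G) -> B. *)
Definition Cc_hom (B : cstaralg) (Phi : (G -> C) -> B) : Prop :=
  [/\ forall (k : C) f h, Cc f -> Cc h ->
        Phi (fun g => k * f g + h g) = k *: Phi f + Phi h,
      forall f h, Cc f -> Cc h -> Phi (convolution f h) = cmul (Phi f) (Phi h) &
      forall f, Cc f -> Phi (involution f) = cadj (Phi f)].

(* The enveloping C*-algebra of C_c(G). *)
Definition groupoid_cstar (A : cstaralg) (iota : (G -> C) -> A) : Prop :=
  Cc_hom iota /\
  forall (B : cstaralg) (Phi : (G -> C) -> B), Cc_hom Phi ->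
    exists! f : A -> B, star_hom f /\ forall h, Cc h -> f (iota h) = Phi h.

Definition point_mass (g : G) : G -> C := fun h => (h == g)%:R.

(* The inclusion C(V) = C(G^(0)) -> C_c(G). *)
Definition on_units (a : V -> C) : G -> C :=
  fun g => if g == gid G (gd g) then a (gd g) else 0.

End GroupoidAlgebra.

Section CStarGE.
Variables (E : digraph) (G : groupoid (E0 E)) (a : self_similar_action G).

Definition edge_mass (e : E1 E) : {ffun E1 E -> C} := [ffun f => (f == e)%:R].

(* Right action and inner product of X(E) = C(E^1) over C(E^0). *)
Definition edge_ract (xi : {ffun E1 E -> C}) (c : E0 E -> C) :
    {ffun E1 E -> C} := [ffun e => xi e * c (sr e)].

Definition edge_ip (xi eta : {ffun E1 E -> C}) : E0 E -> C :=
  fun v => \sum_(e | sr e == v) (xi e)^* * eta e.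

(* M is the interior tensor product of X(E) and A = C*(G) over C(E^0), with
   tens xi b standing for the elementary tensor of xi and b. *)
Definition is_tensor (A : cstaralg) (iota : (G -> C) -> A)
    (M : hilbert_module A) (tens : {ffun E1 E -> C} -> A -> M) : Prop :=
  [/\ (forall b, linear (fun xi => tens xi b)) /\
        (forall xi, linear (tens xi)),
      forall xi c b,
        tens (edge_ract xi c) b = tens xi (cmul (iota (on_units c)) b),
      forall xi b d, ract (tens xi b) d = tens xi (cmul b d),
      forall xi eta b d, hip (tens xi b) (tens eta d) =
        cmul (cmul (cadj b) (iota (on_units (edge_ip xi eta)))) d &
      closure (lspan [set x | exists xi b, x = tens xi b]) = setT].

Definition is_left_action_GE (A : cstaralg) (iota : (G -> C) -> A)
    (M : hilbert_module A) (tens : {ffun E1 E -> C} -> A -> M)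
    (phi : A -> M -> M) : Prop :=
  left_action phi /\
  forall g e b, phi (iota (point_mass g)) (tens (edge_mass e) b) =
    if gd g == rg e
    then tens (edge_mass (eact a g e))
              (cmul (iota (point_mass (restr a g e))) b)
    else 0.

Record cstar_GE := CStarGE {
  ge_A : cstaralg;
  ge_iota : (G -> C) -> ge_A;
  ge_groupoid : groupoid_cstar ge_iota;
  ge_M : hilbert_module ge_A;
  ge_tens : {ffun E1 E -> C} -> ge_A -> ge_M;
  ge_tensP : is_tensor ge_iota ge_tens;
  ge_phi : ge_A -> ge_M -> ge_M;
  ge_phiP : is_left_action_GE ge_iota ge_tens ge_phi;
  ge_alg :> cstaralg;
  ge_jA : ge_A -> ge_alg;
  ge_jM : ge_M -> ge_alg;
  ge_pimsner : cuntz_pimsner ge_phi ge_jA ge_jM }.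

#[global] Arguments ge_iota : clear implicits.
#[global] Arguments ge_tens : clear implicits.
#[global] Arguments ge_jA : clear implicits.
#[global] Arguments ge_jM : clear implicits.

Definition ge_U (X : cstar_GE) (g : G) : X := ge_jA X (ge_iota X (point_mass g)).

Definition ge_P (X : cstar_GE) (v : E0 E) : X := ge_U X (gid G v).

(* The image of the point mass at e under xi |-> xi (x) 1, where the unit of
   C*(G) is the indicator function of G^(0). *)
Definition ge_S (X : cstar_GE) (e : E1 E) : X :=
  ge_jM X (ge_tens X (edge_mass e) (ge_iota X (on_units (fun=> 1)))).

End CStarGE.

Section Representations.
Variable H : hilbert.

Definition bounded_op (T : H -> H) : Prop := linear T /\ continuous T.

Definition is_rep (A : cstaralg) (Pi : A -> H -> H) : Prop :=
  [/\ forall b, bounded_op (Pi b),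
      forall x, linear (fun b => Pi b x),
      forall b d x, Pi (cmul b d) x = Pi b (Pi d x) &
      forall b x y, hdot H (Pi b x) y = hdot H x (Pi (cadj b) y)].

Definition nondegenerate (A : cstaralg) (Pi : A -> H -> H) : Prop :=
  closure (lspan [set x | exists b y, x = Pi b y]) = setT.

Definition closed_subspace (K : set H) : Prop :=
  [/\ closed K, K 0 & forall (k : C) x y, K x -> K y -> K (k *: x + y)].

Definition infinite_dimensional (K : set H) : Prop :=
  ~ exists n (b : 'I_n -> H), K `<=` lspan (range b).

(* T is a partial isometry with initial space K and final space L. *)
Definition partial_isometry (T : H -> H) (K L : set H) : Prop :=
  [/\ bounded_op T,
      forall x, K x -> `|T x| = `|x|,
      forall x, (forall y, K y -> hdot H x y = 0) -> T x = 0 &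
      T @` K = L].

Variable E : digraph.

Definition hilbert_bundle (F : E0 E -> set H) : Prop :=
  [/\ forall u, closed_subspace (F u),
      forall u v x y, u != v -> F u x -> F v y -> hdot H x y = 0 &
      forall x, exists f : E0 E -> H, (forall u, F u (f u)) /\ x = \sum_u f u].

(* psi u is a unitary isomorphism from F u onto the direct sum of the spaces
   F (sr e), e in uE^1; psi u x e is the e-th component of psi u x. The e-th
   summand has to be the fiber over sr e, since S_e^* S_e = P_(sr e). *)
Definition similarity (F : E0 E -> set H) (psi : E0 E -> H -> E1 E -> H) : Prop :=
  forall u,
  [/\ forall x e, F u x -> rg e = u -> F (sr e) (psi u x e),
      forall (k : C) x y e, F u x -> F u y -> rg e = u ->
        psi u (k *: x + y) e = k *: psi u x e + psi u y e,
      forall x y, F u x -> F u y ->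
        \sum_(e | rg e == u) hdot H (psi u x e) (psi u y e) = hdot H x y &
      forall z : E1 E -> H, (forall e, rg e = u -> F (sr e) (z e)) ->
        exists x, F u x /\ forall e, rg e = u -> psi u x e = z e].

(* The second clause says pi(S_e) x = psi^-1(0, .., x, .., 0). *)
Definition associated_rep (F : E0 E -> set H) (psi : E0 E -> H -> E1 E -> H)
    (CE : graph_cstar E) (pi : CE -> H -> H) : Prop :=
  [/\ is_rep pi,
      forall u v x, F v x -> pi (gc_P CE u) x = if u == v then x else 0 &
      forall e x, F (sr e) x ->
        F (rg e) (pi (gc_S CE e) x) /\
        forall f, rg f = rg e ->
          psi (rg e) (pi (gc_S CE e) x) f = if f == e then x else 0].

Variable G : groupoid (E0 E).

Definition groupoid_rep (F : E0 E -> set H) (rho : G -> H -> H) : Prop :=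
  (forall g, partial_isometry (rho g) (F (gd g)) (F (gt g))) /\
  forall g h, gd g = gt h -> rho (gmul g h) =1 rho g \o rho h.

Variable a : self_similar_action G.

Definition self_similar (CE : graph_cstar E) (pi : CE -> H -> H)
    (rho : G -> H -> H) : Prop :=
  forall g e, rg e = gd g ->
    rho g \o pi (gc_S CE e) =1 pi (gc_S CE (eact a g e)) \o rho (restr a g e).

Definition generate_rep (X : cstar_GE a) (CE : graph_cstar E)
    (pi : CE -> H -> H) (rho : G -> H -> H) : Prop :=
  exists Pi : X -> H -> H, [/\ is_rep Pi,
    forall g, Pi (ge_U X g) =1 rho g &
    forall e, Pi (ge_S X e) =1 pi (gc_S CE e)].

(* rho is a self-similar representation of G on the Hilbert bundle F, for some
   similarities of its fibers. *)
Definition self_similar_rep (CE : graph_cstar E) (F : E0 E -> set H)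
    (rho : G -> H -> H) : Prop :=
  [/\ hilbert_bundle F, groupoid_rep F rho &
      exists psi (pi : CE -> H -> H),
        [/\ similarity F psi, associated_rep F psi pi & self_similar pi rho]].

(* rho is the restriction to G of a representation Pi of C*(G,E), and F is the
   bundle of the fibers Pi(P_u)H. *)
Definition restricted_rep (X : cstar_GE a) (F : E0 E -> set H)
    (rho : G -> H -> H) : Prop :=
  exists Pi : X -> H -> H, [/\ is_rep Pi, nondegenerate Pi,
    forall u, F u = range (Pi (ge_P X u)) &
    forall g, rho g =1 Pi (ge_U X g)].

End Representations.
End OperatorAlgebras.

(* Main.v *)
Require Import Defs.
From HB Require Import structures.
From mathcomp Require Import all_boot all_order all_algebra.
From mathcomp Require Import sesquilinear.
From mathcomp Require Import complex.
From mathcomp Require Import all_classical all_reals all_analysis.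

Set Implicit Arguments.
Unset Strict Implicit.
Unset Printing Implicit Defensive.

Import Order.TTheory GRing.Theory Num.Theory.
Import numFieldNormedType.Exports.

Local Open Scope classical_set_scope.
Local Open Scope ring_scope.

(** The main point is that [C^*(G,E)], although defined as the Cuntz-Pimsner
    algebra of a correspondence [M] over [A = C^*(G)], is universal for
    covariant families: operators [U g] multiplying like the elements of [G] and
    Cuntz-Krieger isometries [S e] with [U g S e = S (g.e) U (g|e)]. Given that,
    a self-similar pair [(rho, pi)] on [H] is a covariant family in the
    C*-algebra of bounded operators on [H], so it is the image of the generators
    under a representation of [C^*(G,E)]; and in the other direction the
    generators form a covariant family in [C^*(G,E)] itself, a property that
    every representation preserves.

    Universality ([cstar_GE_universal]). The module [M] is the direct sum over
    the edges of the submodules generated by [tbasis e], the elementary tensor of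
    the point mass at [e] and the unit ([tensor_expansion]). A family [U] extends
    to [sigma : A -> B]; set [tau x = \sum_e S_e sigma <tbasis e, x>] and,
    for an adjointable [T] on [M], let its amplification be
    [\sum_(e,f) S_e sigma <tbasis e, T (tbasis f)> S_f^*]. Amplification is
    multiplicative and sends the rank one operator of [x] and [y] to
    [tau x (tau y)^*]. Composed with the left action of [A] it is a
    *-homomorphism on [A] which agrees with [sigma] on point masses, by
    covariance, so that it is [sigma] by uniqueness in the universal property of
    [A]. This is exactly the covariance of [(sigma, tau)] in Pimsner's sense.

    Two places where an analyst would appeal to density or to positivity are
    handled algebraically. That the indicator of the units of [G] is a unit of
    [A], and that its image is a unit of [C^*(G,E)], follows from rigidity alone:
    a *-endomorphism fixing the generators is the identity
    ([generator_unit_is_unit]). Continuity of the inner product of [M] comes from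
    polarization ([hip_norm_bound]).

    For the second equivalence, a nondegenerate representation [Pi] of
    [C^*(G,E)] yields the bundle of ranges of the projections [Pi (P_u)], the
    similarities [x |-> (Pi (S_e)^* x)_e], and a representation of the graph
    algebra through the homomorphism from it to [C^*(G,E)] given by the
    Cuntz-Krieger relations among the [S_e] ([restriction_self_similar]). *)

(** * Hilbert spaces *)

Section HilbertSpace.
Variables (R : realType) (H : hilbert R).
Local Notation C := R[i].
Local Notation "''[' x , y ]" := (hdot H x y) : ring_scope.
Implicit Types (x y z : H) (k : C).

Lemma hdotDl x y z : '[x + y, z] = '[x, z] + '[y, z].
Proof. exact: linearDl. Qed.

Lemma hdotZl k x z : '[k *: x, z] = k * '[x, z].
Proof. exact: linearZl_LR. Qed.

Lemma hdotC x y : '[x, y] = '[y, x]^*.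
Proof. by rewrite (hermC (hdot H)) expr0 mul1r. Qed.

Lemma hdotDr x y z : '[x, y + z] = '[x, y] + '[x, z].
Proof. exact: linearDr. Qed.

Lemma hdotZr k x z : '[x, k *: z] = k^* * '[x, z].
Proof. by rewrite hdotC hdotZl rmorphM/= [in RHS]hdotC. Qed.

Lemma hdot0l x : '[0, x] = 0. Proof. exact: linear0l. Qed.
Lemma hdot0r x : '[x, 0] = 0. Proof. exact: linear0r. Qed.
Lemma hdotBl x y z : '[x - y, z] = '[x, z] - '[y, z].
Proof. exact: linearBl. Qed.
Lemma hdotBr x y z : '[x, y - z] = '[x, y] - '[x, z].
Proof. exact: linearBr. Qed.

Lemma hdot_suml (I : Type) (s : seq I) (Q : pred I) (f : I -> H) x :
  '[\sum_(i <- s | Q i) f i, x] = \sum_(i <- s | Q i) '[f i, x].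
Proof.
by elim/big_rec2: _ => [|i u v _ <-]; rewrite ?hdot0l ?hdotDl.
Qed.

Lemma hdot_eq0 x : '[x, x] = 0 -> x = 0.
Proof.
move=> xx0; apply/eqP; rewrite -normr_eq0 -sqrf_eq0.
by apply/eqP; rewrite hilbert_norm.
Qed.

Lemma hdot_ext x y : (forall z, '[x, z] = '[y, z]) -> x = y.
Proof.
move=> xy; apply/eqP; rewrite -subr_eq0; apply/eqP/hdot_eq0.
by rewrite hdotBl xy subrr.
Qed.

Lemma hdot_extr x y : (forall z, '[z, x] = '[z, y]) -> x = y.
Proof. by move=> xy; apply: hdot_ext => z; rewrite hdotC xy [RHS]hdotC. Qed.

(** The Cauchy-Schwarz inequality, from the squared norm of the component of [y]
    orthogonal to [x]. *)
Lemma hdot_norm_le x y : `|'[x, y]| <= `|x| * `|y|.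
Proof.
have [->|x0] := eqVneq x 0; first by rewrite hdot0l !normr0 mul0r.
have nx0 : 0 < `|x| by rewrite normr_gt0.
have xx0 : '[x, x] != 0 by rewrite -hilbert_norm expf_neq0// gt_eqF.
rewrite -(@ler_pXn2r _ 2) ?nnegrE ?mulr_ge0//.
have : 0 <= '[y - ('[y, x] / '[x, x]) *: x, y - ('[y, x] / '[x, x]) *: x].
  by rewrite -hilbert_norm exprn_ge0.
rewrite hdotBr hdotZr !hdotBl !hdotZl divfK// subrr mulr0 subr0 subr_ge0.
rewrite [in '[x, y]]hdotC => h.
have : `|'[y, x]| ^+ 2 / `|x| ^+ 2 <= `|y| ^+ 2.
  by rewrite normCK mulrAC !hilbert_norm.
rewrite ler_pdivrMr ?exprn_gt0// norm_conjC exprMn.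
by rewrite mulrC.
Qed.

(** Polarization on a subspace: only the values of the form on the two vectors
    and their combinations enter. *)
Lemma hdot_polarization (K : set H) (T : H -> H) x y :
  (forall k u v, K u -> K v -> K (k *: u + v)) -> linear T ->
  (forall u, K u -> `|T u| = `|u|) -> K x -> K y -> '[T x, T y] = '[x, y].
Proof.
move=> KL TL KN Kx Ky.
have TT u : K u -> '[T u, T u] = '[u, u].
  by move=> Ku; rewrite -!hilbert_norm KN.
have re k : k * '[T x, T y] + k^* * '[T y, T x] = k * '[x, y] + k^* * '[y, x].
  have := TT _ (KL k _ _ Kx Ky).
  rewrite TL !hdotDl !hdotDr !hdotZl !hdotZr !TT// !addrA => /addIr.
  by rewrite -!addrA => /addrI.
have := re 1; rewrite !mul1r conjC1 !mul1r => re1.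
have := re 'i; rewrite conjCi !mulNr -!mulrBr => /(mulfI (neq0Ci _)) re2.
have : '[T x, T y] *+ 2 = '[x, y] *+ 2.
  have := congr2 +%R re1 re2.
  by rewrite addrACA subrr addr0 addrACA subrr addr0 -!mulr2n.
move/eqP; rewrite -subr_eq0 -mulrnBl mulrn_eq0 /= subr_eq0.
by move/eqP.
Qed.

(** Norms take values in the complex numbers; suprema of norms need them as
    reals. *)
Definition rnorm x : R := complex.Re `|x|.

Lemma rnormE x : (rnorm x)%:C%C = `|x|.
Proof. by rewrite RRe_real// ger0_real. Qed.

Lemma rnorm_ge0 x : 0 <= rnorm x.
Proof. by rewrite -ler0c rnormE. Qed.

Lemma rnorm_eq0 x : rnorm x = 0 -> x = 0.
Proof. by move=> x0; apply/normr0_eq0; rewrite -rnormE x0. Qed.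

Lemma rnorm_eq0_or_gt0 x : rnorm x = 0 \/ 0 < rnorm x.
Proof.
have [/eqP|x0] := boolP (rnorm x == 0); [by left|right].
by rewrite lt_def x0 rnorm_ge0.
Qed.

End HilbertSpace.

(** * The C*-algebra of bounded operators on a Hilbert space *)

Section Operators.
Variables (R : realType) (H : hilbert R).
Local Notation C := R[i].
Local Notation "''[' x , y ]" := (hdot H x y) : ring_scope.

Definition bounded (T : H -> H) := exists M : R, forall x, rnorm (T x) <= M * rnorm x.
Definition adjoint (T T' : H -> H) := forall x y, '[T x, y] = '[x, T' y].

(** Requiring an adjoint from the start avoids the Riesz representation theorem.
    Linearity ([adjoint_linear]) and a bound on the adjoint ([adjoint_bound])
    come with it. *)
Definition adjointable : pred (H -> H) :=
  [pred T | `[< bounded T /\ exists T', adjoint T T' >]].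

Lemma adjoint_sym T T' : adjoint T T' -> adjoint T' T.
Proof. by move=> TT x y; rewrite hdotC -TT [RHS]hdotC. Qed.

Lemma adjoint_linear T T' : adjoint T T' -> linear T.
Proof.
move=> TT k x y; apply: hdot_ext => z.
by rewrite TT !hdotDl !hdotZl !TT.
Qed.

Lemma adjoint_inj T S S' : adjoint T S -> adjoint T S' -> S = S'.
Proof.
by move=> h h'; apply/funext => y; apply: hdot_extr => x; rewrite -h -h'.
Qed.

Lemma rnorm_leP (x y : H) (M : R) :
  (rnorm x <= M * rnorm y) = (`|x| <= M%:C%C * `|y|).
Proof. by rewrite -lecR rmorphM/= !rnormE. Qed.

(** [|T'y|^2 = <T T'y, y> <= M |T'y| |y|]. *)
Lemma adjoint_bound T T' (M : R) : adjoint T T' ->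
  (forall x, rnorm (T x) <= M * rnorm x) -> forall x, rnorm (T' x) <= M * rnorm x.
Proof.
move=> TT TM y.
have [->|Ty0] := eqVneq (T' y) 0.
  have := TM y; have := rnorm_ge0 (T y) => h1 h2.
  by rewrite /rnorm normr0/=; exact: le_trans h1 h2.
rewrite rnorm_leP; have nTy : 0 < `|T' y| by rewrite normr_gt0.
rewrite -(ler_pM2l nTy) -expr2 hilbert_norm -TT.
have -> : '[T (T' y), y] = `|'[T (T' y), y]|.
  by rewrite ger0_norm// TT -hilbert_norm exprn_ge0.
apply: le_trans (hdot_norm_le _ _) _.
rewrite mulrA ler_wpM2r// mulrC -rnorm_leP; exact: TM.
Qed.

Lemma adjointable_submod : submod_closed adjointable.
Proof.
split.
  apply/asboolP; split.
    by exists 0 => x; rewrite mul0r /rnorm normr0.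
  by exists (fun=> 0) => x y; rewrite hdot0l hdot0r.
move=> k S T /asboolP[[M SM] [S' SS]] /asboolP[[N TN] [T' TT]].
apply/asboolP; split.
  exists (Normc.normc k * M + N) => x; rewrite rnorm_leP -[(_ + _) x]/(k *: S x + T x).
  apply: le_trans (ler_normD _ _) _.
  rewrite rmorphD/= mulrDl lerD//; last by rewrite -rnorm_leP.
  rewrite normrZ rmorphM/=.
  by rewrite -mulrA ler_wpM2l// -rnorm_leP.
exists (fun x => k^* *: S' x + T' x) => x y.
rewrite -[(_ + _) x]/(k *: S x + T x).
by rewrite !hdotDl !hdotDr hdotZl hdotZr conjCK SS TT.
Qed.
HB.instance Definition _ := GRing.isSubmodClosed.Build C (H -> H) adjointable
  adjointable_submod.

Definition op := {T : H -> H | adjointable T}.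
HB.instance Definition _ := SubType.on op.
HB.instance Definition _ := Choice.on op.
HB.instance Definition _ := [SubChoice_isSubLmodule of op by <:].

End Operators.

Section OperatorNorm.
Variables (R : realType) (H : hilbert R).
Local Notation C := R[i].
Local Notation "''[' x , y ]" := (hdot H x y) : ring_scope.
Implicit Types (S T : op H) (x y z : H) (k : C).

Lemma op_ext S T : (forall x, \val S x = \val T x) -> S = T.
Proof. by move=> ST; apply/val_inj/funext. Qed.

Lemma op_bounded T : bounded (\val T).
Proof. by have /asboolP[] := valP T. Qed.

Lemma op_has_adjoint T : exists T' : H -> H, adjoint (\val T) T'.
Proof. by have /asboolP[] := valP T. Qed.

Lemma op_linear T : linear (\val T).
Proof. by have [T' /adjoint_linear] := op_has_adjoint T. Qed.

Lemma op0 T : \val T 0 = 0.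
Proof.
by have := op_linear T (-1) 0 0; rewrite !scaleN1r oppr0 addr0 addNr.
Qed.

Lemma opDE S T x : \val (S + T) x = \val S x + \val T x.
Proof. by []. Qed.

Lemma opZE k T x : \val (k *: T) x = k *: \val T x.
Proof. by []. Qed.

(** At [x = 0] the ratio is [0 / 0 = 0], which does not change the supremum. *)
Definition opratio T := range (fun x => rnorm (\val T x) / rnorm x).

Definition opnorm T : R := sup (opratio T).

Lemma opnorm_le T M : 0 <= M -> (forall x, rnorm (\val T x) <= M * rnorm x) ->
  opnorm T <= M.
Proof.
move=> M0 TM; apply: ge_sup; first by exists (rnorm (\val T 0) / rnorm (0 : H)); exists 0.
move=> _ [x _ <-]; have [->|] := rnorm_eq0_or_gt0 x => [|x0]; first by rewrite invr0 mulr0.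
by rewrite ler_pdivrMr.
Qed.

Lemma opnorm_bound T x : rnorm (\val T x) <= opnorm T * rnorm x.
Proof.
have [x0|x0] := rnorm_eq0_or_gt0 x.
  by rewrite x0 mulr0 (rnorm_eq0 x0) op0 /rnorm normr0.
rewrite -ler_pdivrMr//; apply: ub_le_sup; last by exists x.
have [M TM] := op_bounded T; exists `|M| => _ [y _ <-].
have [->|] := rnorm_eq0_or_gt0 y => [|y0]; first by rewrite invr0 mulr0.
rewrite ler_pdivrMr//; apply: le_trans (TM y) _.
by rewrite ler_wpM2r ?ler_norm// ltW.
Qed.

Lemma opnorm_ge0 T : 0 <= opnorm T.
Proof.
have [[x x0]|/forallNP h] := pselect (exists x : H, x != 0).
  have [/rnorm_eq0/eqP|nx0] := rnorm_eq0_or_gt0 x; first by rewrite (negPf x0).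
  rewrite -(pmulr_lge0 _ nx0).
  by apply: le_trans (opnorm_bound T x); exact: rnorm_ge0.
apply: ub_le_sup; last by exists 0 => //; rewrite op0 /rnorm normr0 mul0r.
exists 0 => _ [x _ <-].
have /negP := h x; rewrite negbK => /eqP ->.
by rewrite op0 /rnorm normr0 mul0r.
Qed.

Definition opnormC T : C := (opnorm T)%:C%C.

Lemma opnormC_leP T (c : C) : 0 <= c ->
  (forall x, `|\val T x| <= c * `|x|) -> opnormC T <= c.
Proof.
move=> c0 h; have cE : (complex.Re c)%:C%C = c by rewrite RRe_real ?ger0_real.
rewrite /opnormC -cE lecR; apply: opnorm_le; first by rewrite -ler0c cE.
by move=> x; rewrite rnorm_leP cE.
Qed.

Lemma opnormC_bound T x : `|\val T x| <= opnormC T * `|x|.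
Proof. by rewrite -rnorm_leP; exact: opnorm_bound. Qed.

Lemma opnormC_ge0 T : 0 <= opnormC T.
Proof. by rewrite ler0c opnorm_ge0. Qed.

Lemma opnormC_triangle S T : opnormC (S + T) <= opnormC S + opnormC T.
Proof.
apply: opnormC_leP => [|x]; first by rewrite addr_ge0 ?opnormC_ge0.
rewrite opDE mulrDl (le_trans (ler_normD _ _))//.
by rewrite lerD ?opnormC_bound.
Qed.

Lemma opnormC_scale_le k T : opnormC (k *: T) <= `|k| * opnormC T.
Proof.
apply: opnormC_leP => [|x]; first by rewrite mulr_ge0 ?opnormC_ge0.
by rewrite opZE normrZ -mulrA ler_wpM2l// opnormC_bound.
Qed.

Lemma opnormC_eq0 T : opnormC T = 0 -> T = 0.
Proof.
move=> T0; apply: op_ext => x; apply/eqP; rewrite -normr_le0.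
by have := opnormC_bound T x; rewrite T0 mul0r.
Qed.

Lemma opnormC_scale k T : opnormC (k *: T) = `|k| * opnormC T.
Proof.
apply/eqP; rewrite eq_le opnormC_scale_le /=.
have [->|k0] := eqVneq k 0; first by rewrite normr0 mul0r opnormC_ge0.
rewrite mulrC -ler_pdivlMr ?normr_gt0// mulrC -normfV.
by have := opnormC_scale_le k^-1 (k *: T); rewrite scalerK.
Qed.

HB.instance Definition _ := Lmodule_isNormed.Build C (op H)
  opnormC_triangle opnormC_scale opnormC_eq0.

Lemma op_normE T : `|T| = opnormC T. Proof. by []. Qed.

Lemma op_norm_bound T x : `|\val T x| <= `|T| * `|x|.
Proof. exact: opnormC_bound. Qed.

Lemma op_norm_le T (c : C) : 0 <= c ->
  (forall x, `|\val T x| <= c * `|x|) -> `|T| <= c.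
Proof. exact: opnormC_leP. Qed.

End OperatorNorm.

Section OperatorAlgebra.
Variables (R : realType) (H : hilbert R).
Local Notation C := R[i].
Local Notation "''[' x , y ]" := (hdot H x y) : ring_scope.

Lemma op_membership (T T' : H -> H) : bounded T -> adjoint T T' -> adjointable T.
Proof. by move=> bT aT; apply/asboolP; split=> //; exists T'. Qed.

Definition mkop (T T' : H -> H) (bT : bounded T) (aT : adjoint T T') : op H :=
  exist (fun f : H -> H => adjointable f) T (op_membership bT aT).

Definition adj_fun (T : op H) : H -> H := sval (cid (op_has_adjoint T)).

Lemma adj_funP (T : op H) : adjoint (\val T) (adj_fun T).
Proof. exact: svalP (cid (op_has_adjoint T)). Qed.

Lemma adj_fun_bounded (T : op H) : bounded (adj_fun T).
Proof.
have [M TM] := op_bounded T; exists M; exact: adjoint_bound (adj_funP T) TM.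
Qed.

Definition oadj (T : op H) : op H :=
  mkop (adj_fun_bounded T) (adjoint_sym (adj_funP T)).

Lemma oadjP (T : op H) x y : '[\val T x, y] = '[x, \val (oadj T) y].
Proof. exact: adj_funP. Qed.

Lemma oadj_unique (S T : op H) : adjoint (\val T) (\val S) -> oadj T = S.
Proof.
move=> TS; apply: val_inj; apply: adjoint_inj (adj_funP T) TS.
Qed.

Lemma comp_bounded (S T : op H) : bounded (\val S \o \val T).
Proof.
exists (opnorm S * opnorm T) => x; apply: le_trans (opnorm_bound _ _) _.
by rewrite -mulrA ler_wpM2l ?opnorm_ge0// opnorm_bound.
Qed.

Lemma comp_adjoint (S T : op H) :
  adjoint (\val S \o \val T) (\val (oadj T) \o \val (oadj S)).
Proof. by move=> x y /=; rewrite !oadjP. Qed.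

Definition omul (S T : op H) : op H :=
  mkop (comp_bounded S T) (comp_adjoint S T).

Lemma omulE (S T : op H) x : \val (omul S T) x = \val S (\val T x).
Proof. by []. Qed.

Lemma omulA : associative omul.
Proof. by move=> A B D; apply: val_inj. Qed.

Lemma omul_linl B : linear (fun A => omul A B).
Proof. by move=> k A D; apply: op_ext. Qed.

Lemma omul_linr A : linear (omul A).
Proof.
by move=> k B D; apply: op_ext => x; rewrite omulE !opDE !opZE op_linear.
Qed.

Lemma oadjK : involutive oadj.
Proof. by move=> T; apply: oadj_unique; apply: adjoint_sym (oadjP T). Qed.

Lemma oadj_antilin (k : C) S T :
  oadj (k *: S + T) = k^* *: oadj S + oadj T.
Proof.
apply: oadj_unique => x y.
by rewrite !opDE !opZE hdotDl hdotDr hdotZl hdotZr conjCK !oadjP.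
Qed.

Lemma oadjM S T : oadj (omul S T) = omul (oadj T) (oadj S).
Proof. by apply: oadj_unique; exact: comp_adjoint. Qed.

Lemma omul_norm S T : `|omul S T| <= `|S| * `|T|.
Proof.
apply: op_norm_le => [|x]; first by rewrite mulr_ge0.
rewrite omulE (le_trans (op_norm_bound _ _))//.
by rewrite -mulrA ler_wpM2l// op_norm_bound.
Qed.

Lemma oadj_norm_le T : `|oadj T| <= `|T|.
Proof.
rewrite !op_normE lecR; apply: opnorm_le; first exact: opnorm_ge0.
exact: adjoint_bound (oadjP T) (opnorm_bound T).
Qed.

(** The C*-identity: [|T x|^2 = <x, T^*T x> <= |T^*T| |x|^2]. *)
Lemma omul_oadj_norm T : `|omul (oadj T) T| = `|T| ^+ 2.
Proof.
apply/eqP; rewrite eq_le; apply/andP; split.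
  apply: le_trans (omul_norm _ _) _.
  by rewrite expr2 ler_wpM2r// oadj_norm_le.
have s0 : 0 <= sqrtC `|omul (oadj T) T| by rewrite sqrtC_ge0.
rewrite -[leRHS]sqrtCK ler_pXn2r ?nnegrE//.
apply: op_norm_le => // x.
rewrite -(@ler_pXn2r _ 2) ?nnegrE ?mulr_ge0// hilbert_norm oadjP exprMn sqrtCK.
have -> : '[x, \val (oadj T) (\val T x)] = `|'[x, \val (oadj T) (\val T x)]|.
  by rewrite ger0_norm// -oadjP -hilbert_norm exprn_ge0.
apply: le_trans (hdot_norm_le _ _) _.
rewrite mulrC expr2 mulrA ler_wpM2r//; exact: op_norm_bound (omul (oadj T) T) x.
Qed.

(** Applied to the identity and to the adjoint, this produces at once the limit
    of a Cauchy filter of operators and the adjoint of that limit. *)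
Lemma cauchy_pointwise_limit (F : set_system (op H)) (A : op H -> op H) :
  ProperFilter F -> cauchy F -> (forall S T, `|A S - A T| <= `|S - T|) ->
  exists l : H -> H, forall e : C, 0 < e ->
    \forall T \near F, forall x, `|l x - \val (A T) x| <= e * `|x|.
Proof.
move=> PF cF Ac.
have lip (S T : op H) x : `|\val (A S) x - \val (A T) x| <= `|S - T| * `|x|.
  rewrite -[_ - _]/(\val (A S - A T) x).
  by apply: le_trans (op_norm_bound _ _) _; rewrite ler_wpM2r.
have cvx x : cvg ((fun T : op H => \val (A T) x) @ F).
  apply: cauchy_cvg; apply: cauchy_exP => e e0.
  have d0 : 0 < e / (`|x| + 1) by rewrite divr_gt0// ltr_wpDl.
  have /cauchyP/(_ _ d0)[T0 FT0] := cF.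
  exists (\val (A T0) x).
  suff : \forall T \near F, ball (\val (A T0) x) e (\val (A T) x) by [].
  apply: filterS FT0 => T; rewrite -!ball_normE /= => TT0.
  apply: le_lt_trans (lip _ _ _) _.
  have [->|x0] := eqVneq x 0; first by rewrite normr0 mulr0.
  rewrite -ltr_pdivlMr ?normr_gt0//; apply: lt_le_trans TT0 _.
  by rewrite ler_pM2l// lef_pV2 ?posrE ?normr_gt0 ?ltr_wpDl// lerDl.
exists (fun x => lim ((fun T : op H => \val (A T) x) @ F)) => e e0.
have /cauchy_ballP/(_ e e0)/nearP_dep := cF.
apply: filterS => T hT x; have {}hT : \forall S \near F, `|S - T| < e.
  by apply: filterS hT => S; rewrite -ball_normE /= distrC.
apply/ler_addgt0Pr => d d0; near F => S.
rewrite -[X in `|X - _|](subrK (\val (A S) x)) -addrA (le_trans (ler_normD _ _))//.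
rewrite [leRHS]addrC lerD//.
  apply: ltW; near: S.
  by have /cvgrPdist_lt/(_ d d0) := cvx x.
apply: le_trans (lip _ _ _) _; rewrite ler_wpM2r//; apply: ltW.
by near: S.
Unshelve. all: by end_near. Qed.

Lemma oadjB S T : oadj (S - T) = oadj S - oadj T.
Proof.
rewrite -scaleN1r addrC oadj_antilin rmorphN rmorph1 scaleN1r.
by rewrite addrC.
Qed.

(** The pointwise limits [l] and [l'] of the operators and of their adjoints are
    adjoint to each other, since the form is continuous. *)
Lemma op_complete (F : set_system (op H)) :
  ProperFilter F -> cauchy F -> cvg F.
Proof.
move=> PF cF.
have [l lP] := cauchy_pointwise_limit (A := id) PF cF (fun S T => lexx _).
have oadjc S T : `|oadj S - oadj T| <= `|S - T| by rewrite -oadjB oadj_norm_le.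
have [l' l'P] := cauchy_pointwise_limit PF cF oadjc.
have al : adjoint l l'.
  move=> x y; apply/eqP; rewrite -subr_eq0 -normr_le0; apply/ler_addgt0Pr => e e0.
  rewrite add0r; set d := `|x| * `|y| + 1.
  have d0 : 0 < d by rewrite ltr_wpDl// mulr_ge0.
  have ed0 : 0 < e / (d *+ 2) by rewrite divr_gt0// mulrn_wgt0.
  near F => T.
  have lT : forall x, `|l x - \val T x| <= e / (d *+ 2) * `|x| by near: T; exact: lP.
  have l'T : forall x, `|l' x - \val (oadj T) x| <= e / (d *+ 2) * `|x|.
    by near: T; exact: l'P.
  (* [T] and its adjoint contribute terms that cancel. *)
  have -> : '[l x, y] - '[x, l' y] =
      '[l x - \val T x, y] - '[x, l' y - \val (oadj T) y].
    by rewrite hdotBl hdotBr oadjP opprB addrA subrK.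
  apply: le_trans (ler_normB _ _) _.
  apply: (@le_trans _ _ (e / (d *+ 2) * d + e / (d *+ 2) * d)); last first.
    by rewrite -mulrDr -mulr2n divfK ?gt_eqF ?mulrn_wgt0.
  have xyd : `|x| * `|y| <= d by rewrite lerDl.
  rewrite lerD//; apply: le_trans (hdot_norm_le _ _) _.
    apply: (@le_trans _ _ (e / (d *+ 2) * `|x| * `|y|)); first by rewrite ler_wpM2r.
    by rewrite -mulrA ler_wpM2l// ltW.
  apply: (@le_trans _ _ (`|x| * (e / (d *+ 2) * `|y|))); first by rewrite ler_wpM2l.
  by rewrite mulrCA ler_wpM2l// ltW.
have bl : bounded l.
  near F => T.
  have lT : forall x, `|l x - \val T x| <= 1 * `|x| by near: T; exact: lP.
  exists (1 + opnorm T) => x; rewrite rnorm_leP rmorphD/= mulrDl.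
  rewrite -[l x](subrK (\val T x)) (le_trans (ler_normD _ _))// lerD//.
  exact: opnormC_bound.
apply/cvg_ex; exists (mkop bl al); apply/cvgrPdist_le => e e0.
apply: filterS (lP e e0) => T lT.
by apply: op_norm_le => //; exact: ltW.
Unshelve. all: by end_near. Qed.

HB.instance Definition _ := Uniform_isComplete.Build (op H) op_complete.

Definition op_cstaralg : cstaralg R :=
  @CStarAlg R (op H) omul oadj omulA omul_linl omul_linr oadjK oadj_antilin
    oadjM omul_norm omul_oadj_norm.

End OperatorAlgebra.

(** * Algebra in C*-algebras *)

Section LinearMaps.
Variables (K : pzRingType) (U V : lmodType K) (f : U -> V).
Hypothesis f_lin : linear f.

Lemma lin0 : f 0 = 0.
Proof.
by have := f_lin (-1) 0 0; rewrite !scaleN1r oppr0 addr0 addNr.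
Qed.

Lemma linD x y : f (x + y) = f x + f y.
Proof. by have := f_lin 1 x y; rewrite !scale1r. Qed.

Lemma linZ k x : f (k *: x) = k *: f x.
Proof. by have := f_lin k x 0; rewrite lin0 !addr0. Qed.

Lemma linN x : f (- x) = - f x.
Proof. by rewrite -scaleN1r linZ scaleN1r. Qed.

Lemma linB x y : f (x - y) = f x - f y.
Proof. by rewrite linD linN. Qed.

Lemma lin_sum (I : Type) (s : seq I) (Q : pred I) (g : I -> U) :
  f (\sum_(i <- s | Q i) g i) = \sum_(i <- s | Q i) f (g i).
Proof.
by elim/big_rec2: _ => [|i u v _ <-]; rewrite ?lin0 ?linD.
Qed.

End LinearMaps.

Section CStarAlgebra.
Variables (R : realType) (A : cstaralg R).
Local Notation C := R[i].
Local Notation "a ** b" := (cmul a b) (at level 40, left associativity).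
Local Notation "a ^!" := (cadj a).
Implicit Types (a b u : A) (k : C).

Lemma cmul0l b : 0 ** b = 0. Proof. exact: lin0 (cmul_linl b). Qed.
Lemma cmul0r b : b ** 0 = 0. Proof. exact: lin0 (cmul_linr b). Qed.
Lemma cmulDl a a' b : (a + a') ** b = a ** b + a' ** b.
Proof. exact: (linD (cmul_linl b)). Qed.
Lemma cmulDr a b b' : a ** (b + b') = a ** b + a ** b'.
Proof. exact: (linD (cmul_linr a)). Qed.
Lemma cmulBl a a' b : (a - a') ** b = a ** b - a' ** b.
Proof. exact: (linB (cmul_linl b)). Qed.
Lemma cmulBr a b b' : a ** (b - b') = a ** b - a ** b'.
Proof. exact: (linB (cmul_linr a)). Qed.
Lemma cmulZl k a b : (k *: a) ** b = k *: (a ** b).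
Proof. exact: (linZ (cmul_linl b)). Qed.
Lemma cmulZr k a b : a ** (k *: b) = k *: (a ** b).
Proof. exact: (linZ (cmul_linr a)). Qed.
Lemma cmul_suml (I : Type) (s : seq I) (Q : pred I) (f : I -> A) b :
  (\sum_(i <- s | Q i) f i) ** b = \sum_(i <- s | Q i) f i ** b.
Proof. exact: (lin_sum (cmul_linl b)). Qed.
Lemma cmul_sumr (I : Type) (s : seq I) (Q : pred I) (f : I -> A) b :
  b ** (\sum_(i <- s | Q i) f i) = \sum_(i <- s | Q i) b ** f i.
Proof. exact: (lin_sum (cmul_linr b)). Qed.

Lemma cadjD a b : (a + b)^! = a^! + b^!.
Proof. by have := cadj_antilin 1 a b; rewrite conjC1 !scale1r. Qed.
Lemma cadj0 : (0 : A)^! = 0.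
Proof. by apply: (@addrI _ (0 : A)^!); rewrite -cadjD !addr0. Qed.
Lemma cadjZ k a : (k *: a)^! = k^* *: a^!.
Proof. by have := cadj_antilin k a 0; rewrite cadj0 !addr0. Qed.
Lemma cadjN a : (- a)^! = - a^!.
Proof. by apply: (@addrI _ (a^!)); rewrite -cadjD !subrr cadj0. Qed.
Lemma cadjB a b : (a - b)^! = a^! - b^!.
Proof. by rewrite cadjD cadjN. Qed.
Lemma cadj_sum (I : Type) (s : seq I) (Q : pred I) (f : I -> A) :
  (\sum_(i <- s | Q i) f i)^! = \sum_(i <- s | Q i) (f i)^!.
Proof. by elim/big_rec2: _ => [|i u v _ <-]; rewrite ?cadj0 ?cadjD. Qed.

Lemma cadj_mul_eq0 a : a^! ** a = 0 -> a = 0.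
Proof.
move=> aa0; apply/eqP; rewrite -normr_eq0 -sqrf_eq0 -cnorm_adj.
by rewrite aa0 normr0.
Qed.

Lemma cnormJ a : `|a^!| = `|a|.
Proof.
suff le b : `|b| <= `|b^!|.
  by apply/eqP; rewrite eq_le le andbT; have := le a^!; rewrite cadjK.
have [->|b0] := eqVneq b 0; first by rewrite normr0.
have nb0 : 0 < `|b| by rewrite normr_gt0.
by rewrite -(ler_pM2r nb0) -expr2 -cnorm_adj cnormM.
Qed.

(** With [w = 2u - 1] in the unitization, conjugation by the self-adjoint
    unitary [w] is a [*]-endomorphism of [A] fixing the generators, hence the
    identity, so that [u] is central. Then [a |-> u a] is also a
    [*]-endomorphism fixing the generators. No density argument is needed. *)
Lemma generator_unit_is_unit u (gen : set A) :
  u ** u = u -> u^! = u ->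
  (forall a, gen a -> u ** a = a /\ a ** u = a) ->
  (forall f : A -> A, star_hom f -> (forall a, gen a -> f a = a) ->
    forall a, f a = a) ->
  forall a, u ** a = a /\ a ** u = a.
Proof.
move=> uu ua ugen rigid.
(* [L] and [L'] are left and right multiplication by [w]. *)
pose L a : A := 2 *: (u ** a) - a; pose L' a : A := 2 *: (a ** u) - a.
have two (x : A) : 2 *: x = x + x by rewrite scaler_nat mulr2n.
have LK a : L (L a) = a.
  by rewrite /L cmulBr cmulZr cmulA uu !two addrK opprB addrCA subrr addr0.
have LM a b : L (a ** b) = L a ** b.
  by rewrite /L cmulBl cmulZl cmulA.
have LM' a b : L' (a ** b) = a ** L' b.
  by rewrite /L' cmulBr cmulZr cmulA.
have LL' a b : L' a ** L b = a ** b.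
  rewrite /L /L' cmulBl !cmulBr !cmulZl !cmulZr !cmulA.
  rewrite -[a ** u ** u]cmulA uu !two.
  by rewrite addrK opprB addrCA subrr addr0.
have comm a : L (L' a) = L' (L a).
  rewrite /L /L' !(cmulBl, cmulBr, cmulZl, cmulZr) !cmulA !scalerBr.
  by rewrite !opprB !addrA addrAC [RHS]addrAC [X in X + _ = _]addrAC.
have Llin : linear L.
  move=> k a b; rewrite /L cmulDr cmulZr scalerDr opprD addrACA scalerBr.
  by rewrite !scalerA mulrC.
have L'lin : linear L'.
  move=> k a b; rewrite /L' cmulDl cmulZl scalerDr opprD addrACA scalerBr.
  by rewrite !scalerA mulrC.
have Ladj a : (L a)^! = L' a^!.
  by rewrite /L /L' cadjB cadjZ cadjM ua conjC_nat.
have L'adj a : (L' a)^! = L a^!.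
  by rewrite /L /L' cadjB cadjZ cadjM ua conjC_nat.
have LL'id a : L (L' a) = a.
  apply: (rigid (L \o L')).
    split=> [k x y /=|x y /=|x /=].
    - by rewrite L'lin Llin.
    - by rewrite [L (L' x)]comm LL' -LM' -LM comm.
    - by rewrite Ladj L'adj -comm.
  move=> x gx /=; have [ux xu] := ugen _ gx.
  by rewrite /L' xu two addrK /L ux two addrK.
have central a : u ** a = a ** u.
  have := LK (L' a); rewrite LL'id /L /L' => /addIr.
  by move/scalerI; apply; rewrite pnatr_eq0.
have uid a : u ** a = a.
  apply: (rigid (cmul u)).
    split=> [|x y|x]; first exact: cmul_linr.
    - by rewrite [RHS]cmulA -[u ** x ** u]cmulA -(central x) [u ** (u ** x)]cmulA uu cmulA.
    - by rewrite cadjM ua central.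
  by move=> x /ugen[].
by move=> a; split; rewrite // -central.
Qed.

Lemma star_homM (B : cstaralg R) (f : A -> B) a b :
  star_hom f -> f (a ** b) = f a ** f b.
Proof. by case. Qed.

Lemma star_homJ (B : cstaralg R) (f : A -> B) a :
  star_hom f -> f (a^!) = (f a)^!.
Proof. by case. Qed.

End CStarAlgebra.

(** * Finitely supported functions on a groupoid *)

Section Groupoid.
Variables (V : Type) (G : groupoid V).
Implicit Types g h k : G.

Lemma gmulKV g h : gt g = gt h -> gmul g (gmul (ginv g) h) = h.
Proof.
by move=> gh; rewrite gmulA ?gd_inv ?gt_inv// gmul_invr gh gmul_idl.
Qed.

Lemma gmulK g h : gd g = gt h -> gmul (ginv g) (gmul g h) = h.
Proof. by move=> gh; rewrite gmulA ?gd_inv// gmul_invl gh gmul_idl. Qed.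

Lemma ginvK : involutive (@ginv V G).
Proof.
move=> g; rewrite -(@gmulKV g (ginv (ginv g))) ?gt_inv ?gd_inv//.
by rewrite gmul_invr gt_inv gmul_idr.
Qed.

Lemma gmul_id_id v : gmul (gid G v) (gid G v) = gid G v.
Proof. by rewrite -{1}(gt_id G v) gmul_idl. Qed.

Lemma ginv_id v : ginv (gid G v) = gid G v.
Proof.
rewrite -[LHS]gmul_idr gd_inv gt_id.
by rewrite -{2}(gmul_id_id v) gmulK ?gd_id ?gt_id.
Qed.

End Groupoid.

Section CompactSupport.
Variables (R : realType) (V : finType) (G : groupoid V).
Local Notation C := R[i].
Local Notation "a ** b" := (cmul a b) (at level 40, left associativity).
Local Notation "a ^!" := (cadj a).
Local Notation pm := (point_mass R).
Implicit Types (g h k l : G) (f : G -> C).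

(** Finite supports as lists, so that sums over them are plain iterated sums. *)
Definition covers (s : seq G) f := uniq s /\ forall g, f g != 0 -> g \in s.

Lemma Cc_covers f : Cc f -> exists s, covers s f.
Proof.
move=> ff; exists (finmap.enum_fset (fset_set [set g | f g != 0])); split.
  exact: finmap.fset_uniq.
by move=> g fg; rewrite in_fset_set// inE.
Qed.

Lemma covers_Cc s f : covers s f -> Cc f.
Proof.
by move=> [_ sf]; apply: sub_finite_set (finite_seq s) => g; exact: sf.
Qed.

Lemma pmE g h : pm g h = (h == g)%:R. Proof. by []. Qed.

Lemma covers_pm g : covers [:: g] (pm g).
Proof.
split=> // h; rewrite pmE inE; apply: contraNT => /negPf ->; exact/eqP.
Qed.

Lemma Cc_pm g : Cc (pm g). Proof. exact: covers_Cc (covers_pm g). Qed.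

Lemma Cc0 : Cc ((fun=> 0) : G -> C).
Proof. by apply: (@covers_Cc [::]); split=> // g; rewrite eqxx. Qed.

Lemma covers_lin (c : C) f f' : Cc f -> Cc f' -> exists s,
  [/\ covers s f, covers s f' & covers s (fun g => c * f g + f' g)].
Proof.
move=> /Cc_covers[s [_ sf]] /Cc_covers[t [_ tf]].
exists (undup (s ++ t)); split; split; rewrite ?undup_uniq// => g;
  rewrite mem_undup mem_cat.
- by move/sf => ->.
- by move/tf => ->; rewrite orbT.
- apply: contraNT; rewrite negb_or => /andP[gs gt].
  have /eqP -> : f g == 0 by apply: contraNT gs => /sf.
  have /eqP -> : f' g == 0 by apply: contraNT gt => /tf.
  by rewrite mulr0 addr0.
Qed.

Lemma Cc_lin (c : C) f f' : Cc f -> Cc f' -> Cc (fun g => c * f g + f' g).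
Proof. by move=> Cf /(covers_lin c Cf)[s [_ _ /covers_Cc]]. Qed.

Lemma Cc_sum (I : eqType) (s : seq I) (c : I -> C) (F : I -> G -> C) :
  (forall i, i \in s -> Cc (F i)) -> Cc (fun g => \sum_(i <- s) c i * F i g).
Proof.
elim: s => [|i s IH] CF.
  by under eq_fun do rewrite big_nil; exact: Cc0.
under eq_fun do rewrite big_cons; apply: Cc_lin; first by apply: CF; rewrite mem_head.
by apply: IH => j js; apply: CF; rewrite inE js orbT.
Qed.

Lemma point_mass_expansion s f : covers s f ->
  f = fun x => \sum_(g <- s) f g * pm g x.
Proof.
move=> [us sf]; apply/funext => x; have [xs|xs] := boolP (x \in s).
  rewrite (bigD1_seq x)//= pmE eqxx mulr1 big1 ?addr0// => g gx.
  by rewrite pmE eq_sym (negPf gx) mulr0.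
rewrite big_seq big1 => [|g gs].
  by apply/eqP; apply: contraNT xs => /sf.
by rewrite pmE; case: eqP => [xg|]; [rewrite xg gs in xs|rewrite mulr0].
Qed.

Lemma convolution_covers s f f' x : covers s f ->
  convolution f f' x = \sum_(k <- s | gt k == gt x) f k * f' (gmul (ginv k) x).
Proof.
move=> [us sf]; rewrite /convolution.
rewrite (fsbigE [seq k <- s | gt k == gt x]) ?filter_uniq//.
- rewrite big_filter_cond; apply: eq_bigl => k.
  by case: eqP => //= gk; rewrite mem_set.
- by move=> k /=; rewrite mem_filter => /andP[/eqP].
- move=> k /= gk; rewrite mem_filter gk eqxx /= => ks.
  have /eqP -> : f k == 0 by apply: contraNT ks => /sf.
  by rewrite mul0r.
Qed.

Lemma convolution_pml k f x :
  convolution (pm k) f x = if gt k == gt x then f (gmul (ginv k) x) else 0.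
Proof.
rewrite (convolution_covers _ _ (covers_pm k)) big_mkcond big_seq1.
by rewrite pmE eqxx mul1r.
Qed.

Lemma convolution_pm k l : convolution (pm k) (pm l) =
  if gd k == gt l then pm (gmul k l) else fun=> 0.
Proof.
apply/funext => x; rewrite convolution_pml; have [kl|kl] := eqVneq (gd k) (gt l).
  rewrite !pmE; case: (eqVneq x (gmul k l)) => [->|xkl].
    by rewrite gt_mul// eqxx gmulK// eqxx.
  case: eqP => // kx; case: eqP => // e; case/eqP: xkl.
  by rewrite -e gmulKV.
case: eqP => // kx; rewrite pmE; case: eqP => // e; case/eqP: kl.
by rewrite -e gt_mul ?gt_inv ?gd_inv.
Qed.

Lemma convolution_expansion s t f f' : covers s f -> covers t f' ->
  convolution f f' = fun x => \sum_(k <- s) f k *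
    (\sum_(l <- t) f' l * convolution (pm k) (pm l) x).
Proof.
move=> sf tf; apply/funext => x.
rewrite (convolution_covers _ _ sf) big_mkcond; apply: eq_bigr => k _ /=.
have -> : \sum_(l <- t) f' l * convolution (pm k) (pm l) x =
    convolution (pm k) f' x.
  rewrite convolution_pml; under eq_bigr do rewrite convolution_pml.
  case: eqP => _; last by rewrite big1// => l _; rewrite mulr0.
  by rewrite [in RHS](point_mass_expansion tf).
by rewrite convolution_pml; case: eqP; rewrite ?mulr0.
Qed.

Lemma Cc_convolution_pm k l : Cc (convolution (pm k) (pm l)).
Proof. by rewrite convolution_pm; case: eqP => _; [exact: Cc_pm|exact: Cc0]. Qed.

Lemma involution_expansion s f : covers s f ->
  involution f = fun x => \sum_(g <- s) (f g)^* * pm (ginv g) x.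
Proof.
move=> sf; apply/funext => x; rewrite /involution {1}(point_mass_expansion sf).
rewrite rmorph_sum; apply: eq_bigr => g _.
by rewrite rmorphM/= !pmE conjC_nat (can2_eq (@ginvK _ G) (@ginvK _ G)).
Qed.

Lemma on_unitsE (c : V -> C) :
  on_units c = fun x => \sum_(v <- index_enum V) c v * pm (gid G v) x.
Proof.
apply/funext => x; rewrite /on_units; case: eqP => [xid|xid].
  rewrite (bigD1 (gd x))//= pmE -xid eqxx mulr1 big1 ?addr0// => v vx.
  rewrite pmE; case: eqP => [xv|]; last by rewrite mulr0.
  by move: vx; rewrite xv gd_id eqxx.
rewrite big1// => v _; rewrite pmE; case: eqP => [xv|]; last by rewrite mulr0.
by case: xid; rewrite xv gd_id.
Qed.

(** These relations hold for the images of the point masses under a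
    *-homomorphism on [C_c(G)] ([Cc_hom_family]), and they characterize such
    images ([linear_extension_hom]). *)
Definition groupoid_family (B : cstaralg R) (U : G -> B) :=
  (forall g h, U g ** U h = if gd g == gt h then U (gmul g h) else 0) /\
  (forall g, (U g)^! = U (ginv g)).

Section CcLinear.
Variables (B : cstaralg R) (Phi : (G -> C) -> B).
Hypothesis Phi_lin : forall (c : C) f f', Cc f -> Cc f' ->
  Phi (fun g => c * f g + f' g) = c *: Phi f + Phi f'.

Lemma Cc_lin0 : Phi (fun=> 0) = 0.
Proof.
have := Phi_lin (-1) Cc0 Cc0.
by under eq_fun do rewrite mulr0 addr0; rewrite scaleN1r addNr.
Qed.

Lemma Cc_lin_sum (I : eqType) (s : seq I) (c : I -> C) (F : I -> G -> C) :
  (forall i, i \in s -> Cc (F i)) ->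
  Phi (fun x => \sum_(i <- s) c i * F i x) = \sum_(i <- s) c i *: Phi (F i).
Proof.
elim: s => [|i s IH] CF.
  by under eq_fun do rewrite big_nil; rewrite big_nil Cc_lin0.
have Ci : Cc (F i) by apply: CF; rewrite mem_head.
have Cs j : j \in s -> Cc (F j) by move=> js; apply: CF; rewrite inE js orbT.
under eq_fun do rewrite big_cons; rewrite big_cons -IH//.
by apply: Phi_lin => //; exact: Cc_sum.
Qed.

End CcLinear.

Section Hom.
Variables (B : cstaralg R) (Phi : (G -> C) -> B).
Hypothesis PhiP : Cc_hom Phi.

Let Phi_lin : forall (c : C) f f', Cc f -> Cc f' ->
  Phi (fun g => c * f g + f' g) = c *: Phi f + Phi f'.
Proof. by case: PhiP. Qed.

Lemma Cc_hom_expansion s f : covers s f ->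
  Phi f = \sum_(g <- s) f g *: Phi (pm g).
Proof.
move=> sf; rewrite {1}(point_mass_expansion sf) (Cc_lin_sum Phi_lin)// => g _.
exact: Cc_pm.
Qed.

Lemma Cc_hom_family : groupoid_family (fun g => Phi (pm g)).
Proof.
have [lin mul inv] := PhiP; split=> [g h|g] /=.
  rewrite -mul; [|exact: Cc_pm..].
  by rewrite convolution_pm; case: eqP => // _; exact: Cc_lin0 Phi_lin.
rewrite -inv; last exact: Cc_pm.
congr Phi; apply/funext => x.
by rewrite /involution !pmE conjC_nat (can2_eq (@ginvK _ G) (@ginvK _ G)).
Qed.

Lemma Cc_hom_on_units (c : V -> C) :
  Phi (on_units c) = \sum_v c v *: Phi (pm (gid G v)).
Proof. by rewrite on_unitsE (Cc_lin_sum Phi_lin)// => v _; exact: Cc_pm. Qed.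

End Hom.

Section Extension.
Variables (B : cstaralg R) (U : G -> B).
Hypothesis UP : groupoid_family U.

(** The sum over all of [G] has finite support when [f] does. *)
Definition linear_extension f : B := \sum_(g \in [set: G]) f g *: U g.

Lemma linear_extension_covers s f : covers s f ->
  linear_extension f = \sum_(g <- s) f g *: U g.
Proof.
move=> [us sf]; rewrite /linear_extension (fsbigE s)//.
  by apply: eq_bigl => g; rewrite in_setT.
move=> g _ gs; have /eqP -> : f g == 0 by apply: contraNT gs => /sf.
by rewrite scale0r.
Qed.

Lemma linear_extension_pm g : linear_extension (pm g) = U g.
Proof.
by rewrite (linear_extension_covers (covers_pm g)) big_seq1 pmE eqxx scale1r.
Qed.

Lemma linear_extension_lin (c : C) f f' : Cc f -> Cc f' ->
  linear_extension (fun g => c * f g + f' g) =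
  c *: linear_extension f + linear_extension f'.
Proof.
move=> Cf /(covers_lin c Cf)[s [sf sf' sl]].
rewrite !(@linear_extension_covers s)// scaler_sumr -big_split.
by apply: eq_bigr => g _; rewrite scalerDl scalerA.
Qed.

(** Both sides of each identity are determined by their values on point masses,
    where they are the hypotheses on [U]. *)
Lemma linear_extension_hom : Cc_hom linear_extension.
Proof.
have [Umul Uadj] := UP; split=> [c f f'|f f'|f]; first exact: linear_extension_lin.
  move=> /Cc_covers[s sf] /Cc_covers[t tf].
  rewrite (convolution_expansion sf tf) (Cc_lin_sum linear_extension_lin); last first.
    by move=> k _; apply: Cc_sum => l _; exact: Cc_convolution_pm.
  rewrite (linear_extension_covers sf) (linear_extension_covers tf) cmul_suml.
  apply: eq_bigr => k _; rewrite (Cc_lin_sum linear_extension_lin); last first.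
    by move=> l _; exact: Cc_convolution_pm.
  rewrite cmul_sumr scaler_sumr; apply: eq_bigr => l _.
  rewrite cmulZl cmulZr Umul convolution_pm; case: eqP => _.
    by rewrite linear_extension_pm.
  by rewrite (Cc_lin0 linear_extension_lin) !scaler0.
move=> /Cc_covers[s sf]; rewrite (involution_expansion sf).
rewrite (Cc_lin_sum linear_extension_lin) => [|g _]; last exact: Cc_pm.
rewrite (linear_extension_covers sf) cadj_sum; apply: eq_bigr => g _.
by rewrite linear_extension_pm cadjZ Uadj.
Qed.

End Extension.

End CompactSupport.

(** * The C*-algebra of a groupoid *)

Section GroupoidFamily.
Variables (R : realType) (V : finType) (G : groupoid V) (B : cstaralg R).
Variables (U : G -> B).
Hypothesis UP : groupoid_family U.
Local Notation "a ** b" := (cmul a b) (at level 40, left associativity).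
Local Notation "a ^!" := (cadj a).

Lemma familyM g h : gd g = gt h -> U g ** U h = U (gmul g h).
Proof. by move=> gh; rewrite UP.1 gh eqxx. Qed.

Lemma family_idl g v : U (gid G v) ** U g = if v == gt g then U g else 0.
Proof. by rewrite UP.1 gd_id; case: eqP => // ->; rewrite gmul_idl. Qed.

Lemma family_idr g v : U g ** U (gid G v) = if gd g == v then U g else 0.
Proof. by rewrite UP.1 gt_id; case: eqP => // <-; rewrite gmul_idr. Qed.

Lemma family_adj_id v : (U (gid G v))^! = U (gid G v).
Proof. by rewrite UP.2 ginv_id. Qed.

Lemma family_invl g : (U g)^! ** U g = U (gid G (gd g)).
Proof. by rewrite UP.2 familyM ?gd_inv// gmul_invl. Qed.

Definition family_unit := \sum_v U (gid G v).

Lemma family_unitl g : family_unit ** U g = U g.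
Proof.
rewrite cmul_suml (bigD1 (gt g))//= family_idl eqxx big1 ?addr0// => v vg.
by rewrite family_idl (negPf vg).
Qed.

Lemma family_unitr g : U g ** family_unit = U g.
Proof.
rewrite cmul_sumr (bigD1 (gd g))//= family_idr eqxx big1 ?addr0// => v vg.
by rewrite family_idr eq_sym (negPf vg).
Qed.

Lemma family_unit_adj : family_unit^! = family_unit.
Proof. by rewrite cadj_sum; apply: eq_bigr => v _; exact: family_adj_id. Qed.

Lemma family_unit_idem : family_unit ** family_unit = family_unit.
Proof. by rewrite {2}/family_unit cmul_sumr; apply: eq_bigr => v _; exact: family_unitl. Qed.

End GroupoidFamily.

Section GroupoidCStar.
Variables (R : realType) (V : finType) (G : groupoid V) (A : cstaralg R).
Variables (iota : (G -> R[i]) -> A).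
Hypothesis iotaP : groupoid_cstar iota.
Local Notation "a ** b" := (cmul a b) (at level 40, left associativity).
Local Notation "a ^!" := (cadj a).
Local Notation pm := (point_mass R).

Let iota_hom : Cc_hom iota := iotaP.1.

Lemma iota_family : groupoid_family (fun g => iota (pm g)).
Proof. exact: Cc_hom_family. Qed.

Lemma star_hom_Cc_hom (B : cstaralg R) (f : A -> B) :
  star_hom f -> Cc_hom (fun h => f (iota h)).
Proof.
move=> [flin fmul fadj]; have [ilin imul iadj] := iota_hom.
split=> [k h h' Ch Ch'|h h' Ch Ch'|h Ch].
- by rewrite ilin// flin.
- by rewrite imul// fmul.
- by rewrite iadj// fadj.
Qed.

(** The uniqueness clause of the universal property, used in place of the
    density of [C_c(G)] in [A]. *)
Lemma groupoid_cstar_ext (B : cstaralg R) (f f' : A -> B) :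
  star_hom f -> star_hom f' ->
  (forall g, f (iota (pm g)) = f' (iota (pm g))) -> forall a, f a = f' a.
Proof.
move=> hf hf' ff' a.
have [k [_ kuniq]] := iotaP.2 _ _ (star_hom_Cc_hom hf').
have <- : k = f.
  apply: kuniq; split=> // h /Cc_covers[s sh].
  rewrite (Cc_hom_expansion (star_hom_Cc_hom hf) sh).
  rewrite (Cc_hom_expansion (star_hom_Cc_hom hf') sh).
  by apply: eq_bigr => g _; rewrite ff'.
by have <- : k = f' by apply: kuniq.
Qed.

Lemma star_hom_id : star_hom (@id A). Proof. by []. Qed.

Lemma iota1E : iota (on_units (fun=> 1)) = family_unit (fun g => iota (pm g)).
Proof.
rewrite (Cc_hom_on_units iota_hom).
by apply: eq_bigr => v _; rewrite scale1r.
Qed.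

Lemma iota1_unit a :
  iota (on_units (fun=> 1)) ** a = a /\ a ** iota (on_units (fun=> 1)) = a.
Proof.
rewrite iota1E; move: a; apply: (@generator_unit_is_unit _ _ _ (range (fun g => iota (pm g)))).
- exact: family_unit_idem iota_family.
- exact: family_unit_adj iota_family.
- move=> _ [g _ <-]; split.
    exact: (family_unitl iota_family).
  exact: (family_unitr iota_family).
- move=> f hf fgen; apply: (groupoid_cstar_ext hf star_hom_id) => g.
  by apply: fgen; exists g.
Qed.

Lemma iota_delta v : iota (on_units (fun w => (w == v)%:R)) = iota (pm (gid G v)).
Proof.
rewrite (Cc_hom_on_units iota_hom) (bigD1 v)//= eqxx scale1r big1 ?addr0//.
by move=> w /negPf ->; rewrite scale0r.
Qed.

End GroupoidCStar.

(** * The correspondence *)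

(** This extends identities known on elementary tensors, or on the range of a
    representation, to the whole space. *)
Lemma linear_eq0_closure (R : realType) (V : normedModType R[i]) (D : V -> V)
    (K : R[i]) (S : set V) :
  0 <= K -> linear D -> (forall x, `|D x| <= K * `|x|) ->
  (forall x, S x -> D x = 0) -> forall x, closure (lspan S) x -> D x = 0.
Proof.
move=> K0 Dlin DK DS x clx.
have DL y : lspan S y -> D y = 0.
  move=> [n [c [a [Sa ->]]]]; rewrite (lin_sum Dlin) big1// => i _.
  by rewrite (linZ Dlin) DS ?scaler0.
apply/eqP; rewrite -normr_le0; apply/ler_addgt0Pr => e e0; rewrite add0r.
have K1 : 0 < K + 1 by rewrite ltr_wpDl.
have [y [Ly]] := clx _ (nbhsx_ballx x _ (divr_gt0 e0 K1)).
rewrite -ball_normE /= => xy; rewrite -(subr0 (D x)) -(DL _ Ly) -(linB Dlin).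
apply: le_trans (DK _) _.
apply: (@le_trans _ _ ((K + 1) * `|x - y|)); first by rewrite ler_wpM2r// lerDl.
by rewrite mulrC -ler_pdivlMr// ltW.
Qed.

Section HilbertModule.
Variables (R : realType) (A : cstaralg R) (M : hilbert_module A).
Local Notation C := R[i].
Local Notation "a ** b" := (cmul a b) (at level 40, left associativity).
Local Notation "a ^!" := (cadj a).
Implicit Types (x y z : M) (a : A) (k : C).

Lemma hipDr x y z : hip x (y + z) = hip x y + hip x z.
Proof. exact: (linD (hip_lin x)). Qed.
Lemma hipZr k x y : hip x (k *: y) = k *: hip x y.
Proof. exact: (linZ (hip_lin x)). Qed.
Lemma hipBr x y z : hip x (y - z) = hip x y - hip x z.
Proof. exact: (linB (hip_lin x)). Qed.
Lemma hip_sumr (I : Type) (s : seq I) (Q : pred I) (f : I -> M) x :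
  hip x (\sum_(i <- s | Q i) f i) = \sum_(i <- s | Q i) hip x (f i).
Proof. exact: (lin_sum (hip_lin x)). Qed.
Lemma hipDl x y z : hip (x + y) z = hip x z + hip y z.
Proof. by rewrite -hip_sym hipDr cadjD !hip_sym. Qed.
Lemma hipZl k x y : hip (k *: x) y = k^* *: hip x y.
Proof. by rewrite -hip_sym hipZr cadjZ hip_sym. Qed.
Lemma hip_suml (I : Type) (s : seq I) (Q : pred I) (f : I -> M) x :
  hip (\sum_(i <- s | Q i) f i) x = \sum_(i <- s | Q i) hip (f i) x.
Proof.
by rewrite -hip_sym hip_sumr cadj_sum; apply: eq_bigr => i _; rewrite hip_sym.
Qed.
Lemma hip_ractl x y a : hip (ract x a) y = a^! ** hip x y.
Proof. by rewrite -hip_sym hip_ract cadjM hip_sym. Qed.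

Lemma hip_eq0 x : hip x x = 0 -> x = 0.
Proof.
by move=> xx0; apply/eqP; rewrite -normr_eq0 -sqrf_eq0 hip_norm xx0 normr0.
Qed.

Lemma hip_ext x y : (forall z, hip z x = hip z y) -> x = y.
Proof.
move=> xy; apply/eqP; rewrite -subr_eq0; apply/eqP/hip_eq0.
by rewrite hipBr xy subrr.
Qed.

(** Polarization gives continuity of the inner product without the
    Cauchy-Schwarz inequality, whose proof would need the order of [A]. *)
Lemma hip_norm_bound x y : `|hip x y| <= (`|x| + 1) ^+ 2 * `|y| *+ 2.
Proof.
have sym_bound (z : M) : `|z| = 1 -> `|hip x z + hip z x| <= (`|x| + 1) ^+ 2 *+ 2.
  move=> z1; have -> : hip x z + hip z x = hip (x + z) (x + z) - (hip x x + hip z z).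
    by rewrite hipDl !hipDr [hip x x + _]addrC addrACA addrK.
  apply: le_trans (ler_normB _ _) _; rewrite mulr2n lerD//.
    rewrite -hip_norm lerXn2r ?nnegrE ?addr_ge0//.
    by rewrite (le_trans (ler_normD _ _))// z1.
  apply: le_trans (ler_normD _ _) _; rewrite -!hip_norm z1 sqrrD lerD2r.
  by rewrite lerDl mulrn_wge0// mulr_ge0.
have unit_bound (z : M) : `|z| = 1 -> `|hip x z| <= (`|x| + 1) ^+ 2 *+ 2.
  move=> z1; have iz1 : `|'i *: z| = 1 by rewrite normrZ normCi mul1r.
  (* The antisymmetric part of [hip x z] is [- 'i] times the symmetric part at
     ['i *: z]. *)
  have e : hip x z *+ 2 =
      (hip x z + hip z x) - 'i *: (hip x ('i *: z) + hip ('i *: z) x).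
    rewrite hipZr hipZl scalerDr !scalerA conjCi mulrN -expr2 sqrCi opprK.
    by rewrite scaleN1r scale1r opprD opprK addrACA subrr addr0 mulr2n.
  have := lerD (sym_bound _ z1) (sym_bound _ iz1).
  rewrite -mulr2n => h; rewrite -(ler_pMn2r (ltn0Sn 1)) -normrMn e.
  apply: le_trans (ler_normB _ _) _.
  by rewrite normrZ normCi mul1r.
have [->|y0] := eqVneq y 0.
  by rewrite (lin0 (hip_lin x)) !normr0 mulr0 mul0rn.
have ny0 : 0 < `|y| by rewrite normr_gt0.
have := unit_bound (`|y|^-1 *: y).
rewrite hipZr !normrZ normfV normr_id mulVf ?gt_eqF// => /(_ erefl).
by rewrite mulrC ler_pdivrMr// mulrnAl.
Qed.

End HilbertModule.

Section Tensor.
Variables (R : realType) (E : digraph) (G : groupoid (E0 E)) (A : cstaralg R).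
Variables (iota : (G -> R[i]) -> A) (M : hilbert_module A).
Variables (tens : {ffun E1 E -> R[i]} -> A -> M).
Hypothesis iotaP : groupoid_cstar iota.
Hypothesis tensP : is_tensor iota tens.
Local Notation C := R[i].
Local Notation "a ** b" := (cmul a b) (at level 40, left associativity).
Local Notation "a ^!" := (cadj a).
Local Notation pm := (point_mass R).
Local Notation one := (iota (on_units (fun=> 1))).
Implicit Types (x y z : M) (a b : A) (k : C) (e f : E1 E).

Definition fiber_proj (v : E0 E) : A := iota (pm (gid G v)).
Definition tbasis e : M := tens (edge_mass R e) one.
(** By [tensor_expansion], the coefficient of [x] at [tbasis e]. *)
Definition tcoord e x : A := hip (tbasis e) x.

Lemma tens_basis e b : tens (edge_mass R e) b = ract (tbasis e) b.
Proof.
have [_ _ tract _ _] := tensP.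
by rewrite /tbasis tract (iota1_unit iotaP b).1.
Qed.

(** The tensor is balanced over [C(E^0)], and the point mass at [e] is supported
    on edges with source [sr e]. *)
Lemma tens_proj e b :
  tens (edge_mass R e) (fiber_proj (sr e) ** b) = tens (edge_mass R e) b.
Proof.
have [_ tbal _ _ _] := tensP.
rewrite /fiber_proj -(iota_delta iotaP) -tbal; congr tens.
by apply/ffunP => f; rewrite !ffunE; case: eqP => [->|]; rewrite ?eqxx ?mulr1// mul0r.
Qed.

Lemma tbasis_proj e : ract (tbasis e) (fiber_proj (sr e)) = tbasis e.
Proof.
have [_ _ tract _ _] := tensP.
by rewrite /tbasis tract -[RHS]tens_proj (iota1_unit iotaP _).1 (iota1_unit iotaP _).2.
Qed.

Lemma tbasis_ip e f : tcoord e (tbasis f) = if e == f then fiber_proj (sr e) else 0.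
Proof.
have [_ _ _ thip _] := tensP.
rewrite /tcoord thip (iota1_unit iotaP _).2 (iota1E iotaP).
rewrite (family_unit_adj (iota_family iotaP)) -(iota1E iotaP) (iota1_unit iotaP _).1.
have [<-|ef] := eqVneq e f.
  rewrite /fiber_proj -(iota_delta iotaP); congr (iota (on_units _)).
  apply/funext => v; rewrite /edge_ip big_mkcond (bigD1 e)//= big1 ?addr0.
    by rewrite !ffunE eqxx conjC1 mulr1 eq_sym; case: eqP.
  by move=> h /negPf he; rewrite !ffunE he conjC0 mul0r if_same.
rewrite -(Cc_lin0 (Phi := iota)); last by case: iotaP => -[].
congr iota; apply/funext => g; rewrite /on_units; case: eqP => // _.
rewrite /edge_ip big1// => h _; rewrite !ffunE.
by have [->|_] := eqVneq h e; rewrite ?conjC0 ?mul0r// (negPf ef) mulr0.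
Qed.

Lemma tcoord_proj e x : fiber_proj (sr e) ** tcoord e x = tcoord e x.
Proof.
rewrite /tcoord -[in RHS](tbasis_proj e) hip_ractl.
by rewrite (family_adj_id (iota_family iotaP)).
Qed.

Lemma tcoord_lin e : linear (tcoord e). Proof. exact: hip_lin. Qed.

Lemma tcoord_ract e x a : tcoord e (ract x a) = tcoord e x ** a.
Proof. exact: hip_ract. Qed.

(** [M] is the direct sum of the modules [tbasis e A]: the identity holds for
    elementary tensors, and the coordinates are continuous. *)
Lemma tensor_expansion x : x = \sum_e ract (tbasis e) (tcoord e x).
Proof.
have [[tlinl tlinr] _ tract _ tdense] := tensP.
pose D x := x - \sum_e ract (tbasis e) (tcoord e x).
(* A bound for the norm of [D], from [hip_norm_bound] and the contractivity
   of the right action. *)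
pose K := 1 + \sum_e `|tbasis e| * ((`|tbasis e| + 1) ^+ 2 *+ 2).
apply/eqP; rewrite -subr_eq0; apply/eqP.
apply: (@linear_eq0_closure _ _ D K [set x | exists xi b, x = tens xi b]).
- by rewrite addr_ge0// sumr_ge0// => e _; rewrite mulr_ge0// mulrn_wge0// exprn_ge0// addr_ge0.
- move=> k y z; rewrite /D scalerBr addrACA -opprD scaler_sumr -big_split/=.
  congr (_ - _); apply: eq_bigr => e _.
  by rewrite tcoord_lin ract_linr.
- move=> y; rewrite /D mulrDl mul1r (le_trans (ler_normB _ _))// lerD//.
  rewrite mulr_suml (le_trans (ler_norm_sum _ _ _))// ler_sum// => e _.
  have nract (z : M) a : `|ract z a| <= `|z| * `|a|.
    rewrite -(@ler_pXn2r _ 2) ?nnegrE ?mulr_ge0// hip_norm hip_ract hip_ractl.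
    rewrite (le_trans (cnormM _ _))// exprMn hip_norm expr2 mulrA ler_wpM2r//.
    by rewrite (le_trans (cnormM _ _))// cnormJ mulrC.
  apply: le_trans (nract _ _) _; rewrite -mulrA ler_wpM2l//.
  by rewrite mulrnAl; exact: hip_norm_bound.
- move=> _ [xi [b ->]].
  have -> : xi = \sum_f xi f *: edge_mass R f.
    apply/ffunP => f; rewrite sum_ffunE (bigD1 f)//= !ffunE eqxx.
    rewrite [_ *: 1]mulr1 big1 ?addr0// => h hf; rewrite !ffunE.
    by rewrite eq_sym (negPf hf) [_ *: _]mulr0.
  rewrite /D (lin_sum (tlinl b)); apply/eqP; rewrite subr_eq0; apply/eqP.
  have Dlin : linear (fun x => \sum_e ract (tbasis e) (tcoord e x)).
    move=> k y z; rewrite scaler_sumr -big_split/=; apply: eq_bigr => e _.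
    by rewrite tcoord_lin ract_linr.
  rewrite (lin_sum Dlin); apply: eq_bigr => f _.
  rewrite (linZ (tlinl b)) (linZ Dlin) tens_basis; congr (_ *: _).
  rewrite (bigD1 f)//= tcoord_ract tbasis_ip eqxx ractA tbasis_proj big1 ?addr0//.
  move=> e ef; rewrite tcoord_ract tbasis_ip (negPf ef) cmul0l.
  exact: lin0 (ract_linr _).
- by rewrite tdense.
Qed.

Lemma tensor_ext x y : (forall e, tcoord e x = tcoord e y) -> x = y.
Proof.
by move=> xy; rewrite (tensor_expansion x) (tensor_expansion y); apply: eq_bigr => e _; rewrite xy.
Qed.

Lemma hip_expansion x y : hip x y = \sum_e (tcoord e x)^! ** tcoord e y.
Proof.
rewrite {1}(tensor_expansion y) hip_sumr; apply: eq_bigr => e _.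
by rewrite hip_ract /tcoord hip_sym.
Qed.

End Tensor.

(** * Universality for covariant families *)

Section SelfSimilarAction.
Variables (E : digraph) (G : groupoid (E0 E)) (a : self_similar_action G).
Implicit Types (g : G) (e : E1 E).

(** The head of the list in the definition of [eact] is never the default value,
    since [g] preserves the length of paths. *)
Lemma eactP g e : rg e = gd g ->
  act a g [:: e] = [:: eact a g e] /\ rg (eact a g e) = gt g.
Proof.
move=> eg; have [_ /(_ 1 isT) [fg _ _] _] := act_piso a g.
have [|] := fg [:: e]; first by split; rewrite //= eg eqxx.
rewrite /eact; case: (act a g [:: e]) => [|e' [|]]//=.
by rewrite andbT => /eqP.
Qed.

Lemma restr_ends g e : rg e = gd g ->
  gd (restr a g e) = sr e /\ gt (restr a g e) = sr (eact a g e).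
Proof.
move=> eg; have [-> -> _] := (restrP a eg (restr a g e)).2 erefl.
by rewrite (eactP eg).1.
Qed.

Lemma eact_id e : eact a (gid G (rg e)) e = e.
Proof. by rewrite /eact act_id//= eqxx. Qed.

(** By the uniqueness of restrictions. *)
Lemma restr_id e : restr a (gid G (rg e)) e = gid G (sr e).
Proof.
apply/esym; apply: (restrP a _ _).1; first by rewrite gd_id.
split; rewrite ?gd_id ?gt_id//; first by rewrite act_id//= eqxx.
move=> xi pxi; rewrite !act_id//=; first by rewrite eqxx.
by rewrite eqxx.
Qed.

End SelfSimilarAction.

(** The relations between the generators of [C^*(G,E)]. When [gd g != rg e] the
    product of [U g] and [S e] vanishes, because [U (gid G (rg e)) S e = S e]
    ([covariant_family_range]). *)
Definition covariant_family (R : realType) (E : digraph) (G : groupoid (E0 E))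
    (a : self_similar_action G) (B : cstaralg R) (U : G -> B) (S : E1 E -> B) :=
  [/\ groupoid_family U,
      forall e f, cmul (cadj (S e)) (S f) = if e == f then U (gid G (sr e)) else 0,
      forall v, \sum_(e | rg e == v) cmul (S e) (cadj (S e)) = U (gid G v) &
      forall g e, rg e = gd g ->
        cmul (U g) (S e) = cmul (S (eact a g e)) (U (restr a g e))].

Section Adjointable.
Variables (R : realType) (A : cstaralg R) (M : hilbert_module A).
Local Notation "a ** b" := (cmul a b) (at level 40, left associativity).
Variables (T T' : M -> M).
Hypothesis TT : adjoint_pair T T'.

Lemma adjoint_pair_sym : adjoint_pair T' T.
Proof. by move=> x y; rewrite -hip_sym -TT hip_sym. Qed.

Lemma adjoint_pair_ract x b : T (ract x b) = ract (T x) b.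
Proof.
by apply: hip_ext => z; rewrite -adjoint_pair_sym !hip_ract adjoint_pair_sym.
Qed.

Lemma adjoint_pair_lin : linear T.
Proof.
move=> k x y; apply: hip_ext => z.
by rewrite -adjoint_pair_sym !hip_lin !adjoint_pair_sym.
Qed.

End Adjointable.

Section Universal.
Variables (R : realType) (E : digraph) (G : groupoid (E0 E)).
Variables (a : self_similar_action G) (X : cstar_GE R a).
Variables (B : cstaralg R) (U : G -> B) (S : E1 E -> B).
Hypothesis US : covariant_family a U S.
Local Notation C := R[i].
Local Notation "a ** b" := (cmul a b) (at level 40, left associativity).
Local Notation "a ^!" := (cadj a).
Local Notation pm := (point_mass R).
Local Notation A := (ge_A X).
Local Notation M := (ge_M X).
Local Notation iota := (ge_iota X).
Local Notation phi := (@ge_phi _ _ _ _ X).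
Local Notation P := (fun v => U (gid G v)).
Local Notation tb := (tbasis (ge_iota X) (ge_tens X)).
Local Notation tc := (tcoord (ge_iota X) (ge_tens X)).
Implicit Types (e f : E1 E) (b : A) (x y : M).

Let iotaP : groupoid_cstar iota := ge_groupoid X.
Let tensP : is_tensor iota (ge_tens X) := ge_tensP X.
Let Ufam : groupoid_family U. Proof. by case: US. Qed.
Let SS e f : (S e)^! ** S f = if e == f then P (sr e) else 0.
Proof. by case: US. Qed.

(** [d = S_e - S_e P] satisfies [d^* d = 0]. *)
Lemma covariant_family_source e : S e ** P (sr e) = S e.
Proof.
apply/eqP; rewrite -subr_eq0; apply/eqP/cadj_mul_eq0.
rewrite cadjB cadjM cmulBl !cmulBr !cmulA -![_ ** (S e)^! ** S e]cmulA SS eqxx.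
rewrite (family_adj_id Ufam) !(family_idl Ufam) gt_id eqxx.
by rewrite (family_idl Ufam) gt_id eqxx !subrr.
Qed.

Lemma covariant_family_range e : P (rg e) ** S e = S e.
Proof.
have [_ _ SSs _] := US; rewrite -SSs cmul_suml (bigD1 e)//= big1 ?addr0.
  by rewrite -cmulA SS eqxx covariant_family_source.
by move=> f /andP[_ fe]; rewrite -cmulA SS (negPf fe) cmul0r.
Qed.

(** Insert [P (gd g) = \sum_e S_e S_e^*] on the right of [U g], then use
    covariance. *)
Lemma covariant_family_decomposition g :
  U g = \sum_(e | rg e == gd g) S (eact a g e) ** U (restr a g e) ** (S e)^!.
Proof.
have [_ _ SSs USg] := US.
have -> : U g = U g ** P (gd g) by rewrite (family_idr Ufam) eqxx.
rewrite -SSs cmul_sumr; apply: eq_bigr => e /eqP eg.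
by rewrite cmulA USg.
Qed.

(** The matrix entries of [T] over the basis, carried into [B] by [sigma] and
    framed by the isometries: this is [sum_(e,f) S_e sigma(<e, T f>) S_f^*]. *)
Section Amplification.
Variables (sigma : A -> B).
Hypothesis sigmaP : star_hom sigma.
Hypothesis sigmaU : forall g, sigma (iota (pm g)) = U g.

Definition tau x : B := \sum_e S e ** sigma (tc e x).

Definition amplification (T : M -> M) : B :=
  \sum_f tau (T (tb f)) ** (S f)^!.

Lemma sigma_proj v : sigma (fiber_proj iota v) = P v.
Proof. exact: sigmaU. Qed.

Lemma tau_lin : linear tau.
Proof.
move=> k x y; rewrite /tau scaler_sumr -big_split; apply: eq_bigr => e _ /=.
rewrite tcoord_lin; case: sigmaP => slin _ _.
by rewrite slin cmulDr cmulZr.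
Qed.

Lemma S_adj_tau e x : (S e)^! ** tau x = sigma (tc e x).
Proof.
rewrite /tau cmul_sumr (bigD1 e)//= big1 ?addr0.
  rewrite cmulA SS eqxx -sigma_proj -(star_homM _ _ sigmaP).
  by rewrite (tcoord_proj iotaP tensP).
by move=> f fe; rewrite cmulA SS eq_sym (negPf fe) cmul0l.
Qed.

Lemma tau_ip x y : (tau x)^! ** tau y = sigma (hip x y).
Proof.
have [slin smul sadj] := sigmaP.
rewrite (hip_expansion iotaP tensP) (lin_sum slin).
rewrite {1}/tau cadj_sum cmul_suml; apply: eq_bigr => e _.
by rewrite cadjM -cmulA S_adj_tau smul sadj.
Qed.

Lemma tau_ract x b : tau (ract x b) = tau x ** sigma b.
Proof.
rewrite /tau cmul_suml; apply: eq_bigr => e _.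
by rewrite tcoord_ract (star_homM _ _ sigmaP) cmulA.
Qed.

Lemma tau_tbasis e : tau (tb e) = S e.
Proof.
have [slin _ _] := sigmaP.
rewrite /tau (bigD1 e)//= (tbasis_ip iotaP tensP) eqxx sigma_proj.
rewrite covariant_family_source big1 ?addr0// => f fe.
by rewrite (tbasis_ip iotaP tensP) (negPf fe) (lin0 slin) cmul0r.
Qed.

Lemma amplification_tau T T' x : adjoint_pair T T' ->
  amplification T ** tau x = tau (T x).
Proof.
move=> TT; rewrite {2}(tensor_expansion iotaP tensP x).
rewrite (lin_sum (adjoint_pair_lin TT)) (lin_sum tau_lin) cmul_suml.
apply: eq_bigr => e _.
by rewrite (adjoint_pair_ract TT) tau_ract -cmulA S_adj_tau.
Qed.

Lemma amplificationM T T' Q : adjoint_pair T T' ->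
  amplification (T \o Q) = amplification T ** amplification Q.
Proof.
move=> TT; rewrite [in RHS]/amplification cmul_sumr; apply: eq_bigr => f _.
by rewrite cmulA (amplification_tau _ TT).
Qed.

Lemma amplification_lin k T Q :
  amplification (fun x => k *: T x + Q x) = k *: amplification T + amplification Q.
Proof.
rewrite /amplification scaler_sumr -big_split; apply: eq_bigr => f _ /=.
by rewrite tau_lin cmulDl cmulZl.
Qed.

Lemma amplificationJ T T' : adjoint_pair T T' ->
  amplification T' = (amplification T)^!.
Proof.
move=> TT; rewrite /amplification cadj_sum /tau.
under [LHS]eq_bigr do rewrite cmul_suml.
under [RHS]eq_bigr do rewrite cadjM cadjK cadj_sum cmul_sumr.
rewrite exchange_big; apply: eq_bigr => e _; apply: eq_bigr => f _ /=.
rewrite cadjM cmulA -(star_homJ _ sigmaP); congr (_ ** sigma _ ** _).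
by rewrite /tcoord hip_sym TT.
Qed.

Lemma amplification_rank_one x y :
  amplification (rank_one x y) = tau x ** (tau y)^!.
Proof.
rewrite /amplification [in (tau y)^!]/tau cadj_sum cmul_sumr.
apply: eq_bigr => f _.
by rewrite /rank_one tau_ract cadjM -(star_homJ _ sigmaP) /tcoord hip_sym cmulA.
Qed.

Lemma phi_adjoint b : adjoint_pair (phi b) (phi b^!).
Proof. by have [[_ _ _ adj] _] := ge_phiP X; exact: adj. Qed.

Lemma amplification_phi_hom : star_hom (fun b => amplification (phi b)).
Proof.
have [[_ plin pmul padj] _] := ge_phiP X.
split=> [k b c|b c|b].
- rewrite -amplification_lin; congr amplification; apply/funext => x.
  exact: plin.
- rewrite -(amplificationM _ (phi_adjoint b)); congr amplification.
  by apply/funext => x; exact: pmul.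
- exact: amplificationJ (phi_adjoint b).
Qed.

(** On point masses this is [covariant_family_decomposition], and the two sides
    are [*]-homomorphisms, hence equal everywhere by universality of [A]. *)
Lemma amplification_phi b : amplification (phi b) = sigma b.
Proof.
move: b; apply: (groupoid_cstar_ext iotaP amplification_phi_hom sigmaP) => g.
rewrite sigmaU covariant_family_decomposition /amplification.
rewrite [RHS]big_mkcond; apply: eq_bigr => f _.
have [_ ->] := ge_phiP X; rewrite eq_sym.
case: eqP => [fg|_]; last by rewrite (lin0 tau_lin) cmul0l.
rewrite (tens_basis iotaP tensP) tau_ract tau_tbasis (iota1_unit iotaP _).2.
by rewrite sigmaU.
Qed.

(** The amplification is the required extension of rank one operators, and by
    [amplification_phi] covariance holds for all of [A]. *)
Lemma covariant_rep_of_family : covariant_rep phi sigma tau.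
Proof.
split; first split.
- by split; [exact: sigmaP|exact: tau_lin].
- exact: tau_ip.
- move=> b x; rewrite -amplification_phi.
  by rewrite (amplification_tau _ (phi_adjoint b)).
- exact: tau_ract.
exists amplification; split; last by move=> b _; exact: amplification_phi.
split=> [k T Q _ _|T Q [[T' TT] _] _|T Q _ _|].
- exact: amplification_lin.
- exact: amplificationM TT.
- exact: amplificationJ.
- exact: amplification_rank_one.
Qed.

End Amplification.

(** The pair [(sigma, tau)] built from the linear extension of [U] is covariant,
    so the universal property of the Cuntz-Pimsner algebra applies to it. *)
Theorem cstar_GE_universal : exists f : X -> B,
  [/\ star_hom f, forall g, f (ge_U X g) = U g & forall e, f (ge_S X e) = S e].
Proof.
have [sigma [[sigmaP sigmaU'] _]] := iotaP.2 _ _ (linear_extension_hom Ufam).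
have sigmaU g : sigma (iota (pm g)) = U g.
  by rewrite sigmaU' ?linear_extension_pm//; exact: Cc_pm.
have [f [[fP fA fM] _]] := (ge_pimsner X).2 _ _ _ (covariant_rep_of_family sigmaP sigmaU).
exists f; split=> // [g|e]; first by rewrite /ge_U fA.
by rewrite /ge_S fM -/(tbasis iota (ge_tens X) e) tau_tbasis.
Qed.

End Universal.

(** * The generators of the Cuntz-Pimsner algebra *)

Section GeneratorRelations.
Variables (R : realType) (E : digraph) (G : groupoid (E0 E)).
Variables (a : self_similar_action G) (X : cstar_GE R a).
Local Notation "a ** b" := (cmul a b) (at level 40, left associativity).
Local Notation "a ^!" := (cadj a).
Local Notation pm := (point_mass R).
Local Notation A := (ge_A X).
Local Notation M := (ge_M X).
Local Notation iota := (ge_iota X).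
Local Notation phi := (@ge_phi _ _ _ _ X).
Local Notation tb := (tbasis (ge_iota X) (ge_tens X)).
Local Notation tc := (tcoord (ge_iota X) (ge_tens X)).
Implicit Types (e f : E1 E) (b : A) (x y : M).

Let iotaP : groupoid_cstar iota := ge_groupoid X.
Let tensP : is_tensor iota (ge_tens X) := ge_tensP X.
Let cov : covariant_rep phi (ge_jA X) (ge_jM X) := (ge_pimsner X).1.
Let toep : toeplitz_rep phi (ge_jA X) (ge_jM X) := cov.1.

Lemma ge_jA_hom : star_hom (ge_jA X). Proof. by have [[]] := toep. Qed.
Lemma ge_U_family : groupoid_family (ge_U X).
Proof. exact: Cc_hom_family (star_hom_Cc_hom iotaP ge_jA_hom). Qed.

Lemma ge_SE e : ge_S X e = ge_jM X (tb e). Proof. by []. Qed.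

Lemma phi_point_mass g e b : phi (iota (pm g)) (ract (tb e) b) =
  if gd g == rg e then ract (tb (eact a g e)) (iota (pm (restr a g e)) ** b)
  else 0.
Proof.
have [_ act] := ge_phiP X; rewrite -(tens_basis iotaP tensP) act.
by case: eqP => // _; rewrite (tens_basis iotaP tensP).
Qed.

Lemma phi_fiber_proj v x :
  phi (fiber_proj iota v) x = \sum_(e | rg e == v) rank_one (tb e) (tb e) x.
Proof.
have [[plin _ _ _] _] := ge_phiP X.
rewrite {1}(tensor_expansion iotaP tensP x) (lin_sum (plin _)).
rewrite [RHS]big_mkcond; apply: eq_bigr => e _ /=.
rewrite /fiber_proj phi_point_mass gd_id eq_sym; case: eqP => // <-.
rewrite eact_id restr_id -/(fiber_proj iota (sr e)) ractA.
by rewrite (tbasis_proj iotaP tensP).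
Qed.

Lemma rank_one_sum_compact (s : seq (E1 E)) :
  compact_op (fun x => \sum_(e <- s) rank_one (tb e) (tb e) x).
Proof.
split.
  exists (fun x => \sum_(e <- s) rank_one (tb e) (tb e) x) => x y.
  rewrite hip_suml hip_sumr; apply: eq_bigr => e _.
  by rewrite /rank_one hip_ract hip_ractl hip_sym.
move=> eps e0; exists [seq (tb e, tb e) | e <- s] => z.
by rewrite big_map subrr normr0 mulr_ge0// ltW.
Qed.

(** By [phi_fiber_proj] the projection [P_v] acts on [M] as a finite sum of rank
    one operators, so it is compact and covariance applies to it. *)
Lemma ge_Cuntz_Krieger v :
  \sum_(e | rg e == v) ge_S X e ** (ge_S X e)^! = ge_P X v.
Proof.
have [_ [Psi [[Plin _ _ Prank] Pphi]]] := cov.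
have PsiE (s : seq (E1 E)) :
    Psi (fun x => \sum_(e <- s) rank_one (tb e) (tb e) x) =
    \sum_(e <- s) ge_S X e ** (ge_S X e)^!.
  elim: s => [|e s IH].
    have c0 := rank_one_sum_compact [::].
    have := Plin (-1) _ _ c0 c0; rewrite scaleN1r addNr big_nil => <-.
    by congr Psi; apply/funext => x; rewrite big_nil scaler0 addr0.
  rewrite big_cons -IH -Prank -[X in X + _]scale1r -Plin.
  - by congr Psi; apply/funext => x; rewrite big_cons scale1r.
  - have := rank_one_sum_compact [:: e].
    by under eq_fun do rewrite big_seq1.
  - exact: rank_one_sum_compact.
have phiE : phi (fiber_proj iota v) =
    fun x => \sum_(e <- [seq e <- index_enum (E1 E) | rg e == v]) rank_one (tb e) (tb e) x.
  by apply/funext => x; rewrite phi_fiber_proj big_filter.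
rewrite /ge_P /ge_U -/(fiber_proj iota v) -Pphi.
  by rewrite phiE PsiE big_filter.
by rewrite phiE; exact: rank_one_sum_compact.
Qed.

Lemma ge_covariant_family : covariant_family a (ge_U X) (ge_S X).
Proof.
have [_ tip tphi tract] := toep.
split=> [|e f|v|g e eg].
- exact: ge_U_family.
- rewrite !ge_SE tip -/(tcoord iota (ge_tens X) e (tb f)) (tbasis_ip iotaP tensP).
  by case: eqP => // _; have [/lin0] := ge_jA_hom.
- exact: ge_Cuntz_Krieger.
- rewrite !ge_SE /ge_U -tphi -tract -[in LHS](tbasis_proj iotaP tensP).
  rewrite phi_point_mass eg eqxx; congr (ge_jM X (ract _ _)).
  have [rd rt] := restr_ends a eg.
  by rewrite /fiber_proj -rd (family_idr (iota_family iotaP)) eqxx.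
Qed.

Definition ge_unit : X := family_unit (ge_U X).

Lemma ge_unitE : ge_unit = ge_jA X (iota (on_units (fun=> 1))).
Proof.
have [jlin _ _] := ge_jA_hom.
by rewrite (iota1E iotaP) /family_unit (lin_sum jlin).
Qed.

Lemma phi_one x : phi (iota (on_units (fun=> 1))) x = x.
Proof.
have [[_ plinr _ _] _] := ge_phiP X.
rewrite (iota1E iotaP) /family_unit (lin_sum (plinr x)).
rewrite [RHS](tensor_expansion iotaP tensP).
rewrite (partition_big (@rg E) predT)//=; apply: eq_bigr => v _.
exact: phi_fiber_proj.
Qed.

(** The unit acts trivially on [M] by [phi_one], hence fixes the images of [A]
    and of [M]; these generate by the uniqueness clause of the universal
    property. *)
Lemma ge_unit_is_unit (z : X) : ge_unit ** z = z /\ z ** ge_unit = z.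
Proof.
have [_ _ tphi tract] := toep; have [jlin jmul jadj] := ge_jA_hom.
move: z; apply: (@generator_unit_is_unit _ _ _ (range (ge_jA X) `|` range (ge_jM X))).
- exact: family_unit_idem ge_U_family.
- exact: family_unit_adj ge_U_family.
- rewrite ge_unitE => _ [[b _ <-]|[x _ <-]].
    by rewrite -!jmul (iota1_unit iotaP b).1 (iota1_unit iotaP b).2.
  rewrite -tphi phi_one -tract; split=> //; congr ge_jM.
  apply: (tensor_ext iotaP tensP) => e.
  by rewrite tcoord_ract (iota1_unit iotaP _).2.
- move=> f fP fgen z.
  have [k [_ kuniq]] := (ge_pimsner X).2 _ _ _ cov.
  have <- : k = f.
    by apply: kuniq; split=> // [b|x]; apply: fgen; [left|right]; exists b || exists x.
  by have -> : k = id by apply: kuniq.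
Qed.

End GeneratorRelations.

(** * Representations on a Hilbert space *)

Section BoundedOperators.
Variables (R : realType) (H : hilbert R).
Local Notation "''[' x , y ]" := (hdot H x y) : ring_scope.

Lemma bounded_op_bounded (T : H -> H) : bounded_op T -> bounded T.
Proof.
move=> [Tlin Tcont].
pose f : {linear H -> H} := HB.pack T (GRing.isLinear.Build _ _ _ _ T Tlin).
have /linear_boundedP/pinfty_ex_gt0[M M0 TM] : bounded_near f (nbhs 0).
  exact/linear_bounded_continuous.
exists (complex.Re M) => x; rewrite rnorm_leP RRe_real ?gtr0_real//; exact: TM.
Qed.

Lemma op_bounded_op (T : op H) : bounded_op (\val T).
Proof.
split; first exact: op_linear.
pose f : {linear H -> H} :=
  HB.pack (\val T) (GRing.isLinear.Build _ _ _ _ (\val T) (op_linear T)).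
apply: (@bounded_linear_continuous _ _ _ f); apply/linear_boundedP.
near=> r => x; apply: le_trans (op_norm_bound T x) _; rewrite ler_wpM2r//.
Unshelve. all: end_near. Qed.

Section Representation.
Variables (B : cstaralg R) (Pi : B -> H -> H).
Hypothesis PiP : is_rep Pi.

Lemma rep_adjoint b : adjoint (Pi b) (Pi (cadj b)).
Proof. by have [_ _ _ adj] := PiP; exact: adj. Qed.

Lemma rep_lin b : linear (Pi b).
Proof. exact: adjoint_linear (rep_adjoint b). Qed.

Lemma rep_mul b c x : Pi (cmul b c) x = Pi b (Pi c x).
Proof. by case: PiP. Qed.

Lemma rep0 x : Pi 0 x = 0.
Proof. by have [_ lin _ _] := PiP; exact: lin0 (lin x). Qed.

Lemma rep_sum (I : Type) (s : seq I) (Q : pred I) (f : I -> B) x :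
  Pi (\sum_(i <- s | Q i) f i) x = \sum_(i <- s | Q i) Pi (f i) x.
Proof. by have [_ lin _ _] := PiP; exact: (@lin_sum _ _ _ _ (lin x) _ s Q f). Qed.

Lemma rep_bounded b : bounded (Pi b).
Proof. by have [bnd _ _ _] := PiP; exact: bounded_op_bounded. Qed.

Definition rep_op b : op_cstaralg H := mkop (rep_bounded b) (rep_adjoint b).

Lemma rep_op_hom : star_hom rep_op.
Proof.
have [_ lin _ _] := PiP; split=> [k b c|b c|b].
- by apply: op_ext => x; exact: lin.
- by apply: op_ext => x; exact: rep_mul.
- by apply/esym/oadj_unique; exact: rep_adjoint.
Qed.

Lemma star_hom_rep (D : cstaralg R) (h : D -> B) :
  star_hom h -> is_rep (fun d => Pi (h d)).
Proof.
have [bnd lin mul adj] := PiP => -[hlin hmul hadj]; split=> [d|x k c d|c d x|d x y].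
- exact: bnd.
- by rewrite hlin lin.
- by rewrite hmul mul.
- by rewrite hadj adj.
Qed.

End Representation.

Lemma op_rep (B : cstaralg R) (h : B -> op_cstaralg H) :
  star_hom h -> is_rep (fun b => \val (h b)).
Proof.
move=> [hlin hmul hadj]; split=> [b|x k b c|b c x|b x y].
- exact: op_bounded_op.
- by rewrite hlin.
- by rewrite hmul.
- by rewrite hadj [LHS]oadjP.
Qed.

End BoundedOperators.

Section Bundle.
Variables (R : realType) (H : hilbert R) (E : digraph) (F : E0 E -> set H).
Hypothesis FP : hilbert_bundle F.
Local Notation "''[' x , y ]" := (hdot H x y) : ring_scope.

Lemma bundle_ext (T T' : H -> H) : linear T -> linear T' ->
  (forall u x, F u x -> T x = T' x) -> forall x, T x = T' x.
Proof.
have [_ _ dec] := FP => Tl T'l TT' x; have [f [Ff ->]] := dec x.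
rewrite (lin_sum Tl) (lin_sum T'l); apply: eq_bigr => u _; exact: TT' (Ff u).
Qed.

Lemma bundle_lin u (k : R[i]) x y : F u x -> F u y -> F u (k *: x + y).
Proof. by have [/(_ u)[_ _ lin] _ _] := FP; exact: lin. Qed.

Lemma bundle_orth u v x y : u != v -> F u x -> F v y -> '[x, y] = 0.
Proof. by have [_ orth _] := FP; exact: orth. Qed.

Section GroupoidRep.
Variables (G : groupoid (E0 E)) (rho : G -> H -> H).
Hypothesis rhoP : groupoid_rep F rho.

Lemma rho_lin g : linear (rho g).
Proof. by have [/(_ g)[[]]] := rhoP. Qed.

Lemma rho_mem g x : F (gd g) x -> F (gt g) (rho g x).
Proof. by have [/(_ g)[_ _ _ <-] _] := rhoP => Fx; exists x. Qed.

(** Distinct fibers are orthogonal, and a partial isometry vanishes on the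
    orthogonal complement of its initial space. *)
Lemma rho_zero g u x : F u x -> u != gd g -> rho g x = 0.
Proof.
have [/(_ g)[_ _ zero _] _] := rhoP => Fx ug; apply: zero => y Fy.
exact: bundle_orth ug Fx Fy.
Qed.

Lemma rho_mul g h x : gd g = gt h -> rho (gmul g h) x = rho g (rho h x).
Proof. by have [_ mul] := rhoP => gh; rewrite mul. Qed.

(** An idempotent is the identity on its range. *)
Lemma rho_id u x : F u x -> rho (gid G u) x = x.
Proof.
have [/(_ (gid G u))[_ _ _ surj] mul] := rhoP; rewrite gt_id gd_id in surj.
rewrite -{1}surj => -[y Fy <-].
by rewrite -rho_mul ?gd_id ?gt_id// gmul_id_id.
Qed.

Lemma rho_isometry g x y : F (gd g) x -> F (gd g) y -> '[rho g x, rho g y] = '[x, y].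
Proof.
have [/(_ g)[_ iso _ _] _] := rhoP.
by apply: hdot_polarization iso; [exact: bundle_lin|exact: rho_lin].
Qed.

(** By bilinearity the identity is checked on fibers. The one case where both
    sides may be nonzero is [x] in the fiber of [gd g] and [y = rho g z], where
    it is the isometry property. *)
Lemma rho_adjoint g : adjoint (rho g) (rho (ginv g)).
Proof.
suff fib u v x y : F u x -> F v y -> '[rho g x, y] = '[x, rho (ginv g) y].
  have [_ _ dec] := FP => x y; have [f [Ff ->]] := dec x; have [f' [Ff' ->]] := dec y.
  rewrite (lin_sum (rho_lin g)) (lin_sum (rho_lin _)) !hdot_suml.
  apply: eq_bigr => u _; rewrite hdotC [RHS]hdotC !hdot_suml; congr (_^*).
  by apply: eq_bigr => v _; rewrite hdotC (fib u v)// -hdotC.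
have [/(_ g)[_ _ _ surj] _] := rhoP.
move=> Fx Fy; have [ug|ug] := eqVneq u (gd g); have [vg|vg] := eqVneq v (gt g).
- subst u v; move: (Fy); rewrite -surj => -[z Fz <-].
  rewrite rho_isometry// -rho_mul ?gd_inv// gmul_invl rho_id//.
- subst u; rewrite (rho_zero Fy) ?gd_inv// hdot0r.
  by rewrite (bundle_orth _ (rho_mem Fx) Fy)// eq_sym.
- subst v; rewrite (rho_zero Fx ug) hdot0l (bundle_orth ug Fx)//.
  by rewrite -(gt_inv g); apply: rho_mem; rewrite gd_inv.
- by rewrite (rho_zero Fx ug) (rho_zero Fy) ?gd_inv// hdot0l hdot0r.
Qed.

Lemma rho_bounded g : bounded (rho g).
Proof. by have [/(_ g)[bnd _ _ _] _] := rhoP; exact: bounded_op_bounded. Qed.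

Definition rho_op g : op_cstaralg H := mkop (rho_bounded g) (rho_adjoint g).

Lemma rho_op_family : groupoid_family rho_op.
Proof.
split=> [g h|g]; last by apply: oadj_unique; exact: rho_adjoint.
case: eqP => [gh|/eqP gh]; apply: op_ext => /=; first by move=> x; rewrite -rho_mul.
apply: bundle_ext => [k x y /=|k x y|u x Fx /=].
- by rewrite !rho_lin.
- by rewrite scaler0 addr0.
have [uh|uh] := eqVneq u (gd h).
  by subst u; rewrite (rho_zero (rho_mem Fx))// eq_sym.
by rewrite (rho_zero Fx uh) (lin0 (rho_lin g)).
Qed.

End GroupoidRep.
End Bundle.

(** * Self-similar representations and representations of the algebra *)

Section SelfSimilarToCovariant.
Variables (R : realType) (E : digraph) (G : groupoid (E0 E)).
Variables (a : self_similar_action G) (CE : graph_cstar R E) (H : hilbert R).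
Variables (F : E0 E -> set H) (psi : E0 E -> H -> E1 E -> H).
Variables (pi : CE -> H -> H) (rho : G -> H -> H).
Hypothesis FP : hilbert_bundle F.
Hypothesis psiP : similarity F psi.
Hypothesis piP : associated_rep F psi pi.
Hypothesis rhoP : groupoid_rep F rho.
Local Notation "''[' x , y ]" := (hdot H x y) : ring_scope.

Let pi_rep : is_rep pi. Proof. by case: piP. Qed.

Lemma rho_id_pi u x : rho (gid G u) x = pi (gc_P CE u) x.
Proof.
have [_ piF _] := piP.
apply: (bundle_ext FP (rho_lin rhoP _) (rep_lin pi_rep _)) => v {}x Fx.
rewrite (piF _ v)//; have [->|uv] := eqVneq u v; first exact: (rho_id rhoP Fx).
by rewrite (rho_zero FP rhoP Fx)// gd_id eq_sym.
Qed.

Lemma rho_id_mem u x : F u (rho (gid G u) x).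
Proof.
have [_ _ dec] := FP; have [f [Ff ->]] := dec x.
rewrite (lin_sum (rho_lin rhoP _)) (bigD1 u)//= (rho_id rhoP (Ff u)).
rewrite big1 ?addr0// => v vu.
by rewrite (rho_zero FP rhoP (Ff v))// gd_id.
Qed.

Lemma pi_S_source e x : pi (gc_S CE e) x = pi (gc_S CE e) (rho (gid G (sr e)) x).
Proof.
have [_ _ SSS SS _] := gc_rel CE.
by rewrite rho_id_pi -rep_mul// -SS cmulA SSS.
Qed.

(** The ranges lie in different summands of the similarity, or in different
    fibers. *)
Lemma pi_S_orthogonal e f x y : e != f ->
  '[pi (gc_S CE e) x, pi (gc_S CE f) y] = 0.
Proof.
move=> ef; rewrite pi_S_source [pi (gc_S CE f) y]pi_S_source.
have [_ _ piS] := piP.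
have [Fe psie] := piS e _ (rho_id_mem (sr e) x).
have [Ff psif] := piS f _ (rho_id_mem (sr f) y).
have [rr|rr] := eqVneq (rg e) (rg f); last exact: (bundle_orth FP rr).
have [_ _ ip _] := psiP (rg e); rewrite -ip//; last by rewrite rr.
rewrite big1// => k /eqP kr; rewrite psie// rr psif -?rr//.
have [->|_] := eqVneq k e; last by rewrite hdot0l.
by rewrite (negPf ef) hdot0r.
Qed.

Lemma self_similar_covariant : self_similar a pi rho ->
  covariant_family a (rho_op FP rhoP) (fun e => rep_op pi_rep (gc_S CE e)).
Proof.
have hom := rep_op_hom pi_rep; have [opl opm opj] := hom.
have [_ _ _ SS CK] := gc_rel CE.
have idE u : rho_op FP rhoP (gid G u) = rep_op pi_rep (gc_P CE u).
  by apply: op_ext => x; exact: rho_id_pi.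
move=> ss; split=> [|e f|v|g e eg].
- exact: rho_op_family.
- rewrite -opj -opm; have [<-|ef] := eqVneq e f; first by rewrite SS idE.
  apply: op_ext => x; apply: hdot_extr => y /=.
  rewrite rep_mul// hdot0r -(adjoint_sym (rep_adjoint pi_rep _)) cadjK.
  exact: pi_S_orthogonal.
- rewrite idE -CK (lin_sum opl); apply: eq_bigr => e _.
  by rewrite opm opj.
- by apply: op_ext => x; exact: ss.
Qed.

(** Forwards by universality, backwards because the generators of [X] already
    satisfy the self-similarity relation. *)
Lemma self_similar_iff_generate (X : cstar_GE R a) :
  self_similar a pi rho <-> generate_rep X pi rho.
Proof.
split=> [ss|[Pi [PiP PiU PiS]] g e eg x /=].
  have [f [fP fU fS]] := cstar_GE_universal X (self_similar_covariant ss).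
  exists (fun b => \val (f b)); split=> [|g x|e x]; first exact: op_rep.
    by rewrite fU.
  by rewrite fS.
have [_ _ _ rel] := ge_covariant_family X.
by rewrite -!PiU -!PiS -!rep_mul// rel.
Qed.

End SelfSimilarToCovariant.

Lemma rep_fixed_closure (R : realType) (H : hilbert R) (B : cstaralg R)
    (Pi : B -> H -> H) (b : B) (S : set H) :
  is_rep Pi -> (forall x, S x -> Pi b x = x) ->
  forall x, closure (lspan S) x -> Pi b x = x.
Proof.
move=> PiP fixS x clx; apply/eqP; rewrite -subr_eq0; apply/eqP.
have [M PiM] := rep_bounded PiP b.
have M0 : 0 <= (`|M|)%:C%C :> R[i] by rewrite ler0c.
apply: (@linear_eq0_closure _ _ (fun y => Pi b y - y) ((`|M|)%:C%C + 1) S) => //.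
- by rewrite addr_ge0.
- by move=> k y z; rewrite (rep_lin PiP) scalerBr addrACA -opprD.
- move=> y; rewrite mulrDl mul1r (le_trans (ler_normB _ _))// lerD//.
  rewrite -rnorm_leP (le_trans (PiM y))// ler_wpM2r ?rnorm_ge0//.
  exact: ler_norm.
- by move=> y Sy; rewrite fixS// subrr.
Qed.

Section CovariantToSelfSimilar.
Variables (R : realType) (E : digraph) (G : groupoid (E0 E)).
Variables (a : self_similar_action G) (X : cstar_GE R a) (CE : graph_cstar R E).
Variables (H : hilbert R) (Pi : X -> H -> H) (F : E0 E -> set H).
Hypothesis PiP : is_rep Pi.
Hypothesis Pi_nondeg : Defs.nondegenerate Pi.
Hypothesis FE : forall u, F u = range (Pi (ge_P X u)).
Local Notation "''[' x , y ]" := (hdot H x y) : ring_scope.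
Local Notation P := (ge_P X).
Local Notation S := (ge_S X).
Local Notation U := (ge_U X).
Local Notation "a ** b" := (cmul a b) (at level 40, left associativity).
Local Notation "a ^!" := (cadj a).

Let cov : covariant_family a U S := ge_covariant_family X.
Let Ufam : groupoid_family U := ge_U_family X.
Let SS e f : (S e)^! ** S f = if e == f then P (sr e) else 0.
Proof. by case: cov. Qed.

Lemma ge_P_mul u v : P u ** P v = if u == v then P u else 0.
Proof. by rewrite (family_idr Ufam) gd_id. Qed.

Lemma fiberP u x : F u x <-> Pi (P u) x = x.
Proof.
rewrite FE; split=> [[y _ <-]|<-]; last by exists x.
by rewrite -rep_mul// ge_P_mul eqxx.
Qed.

Lemma fiber_mem u x : F u (Pi (P u) x).
Proof. by rewrite FE; exists x. Qed.

Lemma fiber_mem_mul u (b : X) x : P u ** b = b -> F u (Pi b x).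
Proof. by move=> ub; apply/fiberP; rewrite -rep_mul// ub. Qed.

(** Nondegeneracy is what makes the fibers exhaust [H]. *)
Lemma Pi_unit x : Pi (ge_unit X) x = x.
Proof.
apply: (rep_fixed_closure (S := [set x | exists b y, x = Pi b y]) PiP).
  by move=> _ [b [y ->]]; rewrite -rep_mul// (ge_unit_is_unit b).1.
by rewrite Pi_nondeg.
Qed.

Lemma fiber_bundle : hilbert_bundle F.
Proof.
split=> [u|u v x y uv /fiberP Fx /fiberP Fy|x].
- split=> [x clx||k x y /fiberP Fx /fiberP Fy].
  + apply/fiberP/(rep_fixed_closure (S := F u) PiP); first by move=> y /fiberP.
    apply: closure_subset clx => y Fy.
    exists 1%N, (fun=> 1), (fun=> y); split=> //.
    by rewrite big_ord1 scale1r.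
  + by apply/fiberP; exact: lin0 (rep_lin PiP _).
  + by apply/fiberP; rewrite (rep_lin PiP) Fx Fy.
- rewrite -Fx -Fy (rep_adjoint PiP) -rep_mul// (family_adj_id Ufam) ge_P_mul.
  by rewrite (negPf uv) rep0// hdot0r.
- exists (fun u => Pi (P u) x); split=> [u|]; first exact: fiber_mem.
  by rewrite -rep_sum// Pi_unit.
Qed.

Lemma restriction_groupoid_rep : groupoid_rep F (fun g => Pi (U g)).
Proof.
have Ud g x : Pi (U g) x = Pi (U g) (Pi (P (gd g)) x).
  by rewrite -rep_mul// (family_idr Ufam) eqxx.
split=> [g|g h gh x /=]; last by rewrite -rep_mul// (familyM Ufam gh).
split.
- by have [bnd _ _ _] := PiP; exact: bnd.
- move=> x /fiberP Fx; apply/eqP.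
  rewrite -(@eqrXn2 _ 2) ?nnegrE// !hilbert_norm (rep_adjoint PiP) -rep_mul//.
  by rewrite (family_invl Ufam) -/(ge_P X _) Fx.
- move=> x xF; rewrite Ud; suff -> : Pi (P (gd g)) x = 0 by exact: lin0 (rep_lin PiP _).
  apply: hdot_extr => y; rewrite hdot0r -[P _](family_adj_id Ufam).
  rewrite -(rep_adjoint PiP) hdotC xF ?conjC0//; exact: fiber_mem.
- apply/seteqP; split=> [_ [x _ <-]|y /fiberP Fy].
    by apply: fiber_mem_mul; rewrite (family_idl Ufam) eqxx.
  exists (Pi (U (ginv g)) y).
    by apply: fiber_mem_mul; rewrite (family_idl Ufam) gt_inv eqxx.
  by rewrite -rep_mul// (familyM Ufam) ?gt_inv// gmul_invr.
Qed.

Lemma ge_graph_relations : graph_relations P S.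
Proof.
split=> [u|u v uv|e|e|u].
- by rewrite (family_adj_id Ufam) ge_P_mul eqxx.
- by rewrite ge_P_mul (negPf uv).
- by rewrite -cmulA SS eqxx (covariant_family_source cov).
- by rewrite SS eqxx.
- by case: cov.
Qed.

Definition component_similarity (u : E0 E) (x : H) (e : E1 E) : H := Pi (S e)^! x.

Lemma component_similarityP : similarity F component_similarity.
Proof.
have [_ _ CK _] := cov.
move=> u; split=> [x e _ _|k x y e _ _ _|x y /fiberP Fx _|z Fz].
- apply: fiber_mem_mul; rewrite -[P _](family_adj_id Ufam) -cadjM.
  by rewrite (covariant_family_source cov).
- exact: rep_lin.
- rewrite -[in RHS]Fx /ge_P -CK rep_sum// hdot_suml; apply: eq_bigr => e _.
  by rewrite rep_mul// (rep_adjoint PiP (S e)).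
- exists (\sum_(e | rg e == u) Pi (S e) (z e)); split=> [|f fu].
    apply/fiberP; rewrite (lin_sum (rep_lin PiP _)); apply: eq_bigr => e /eqP <-.
    by rewrite -rep_mul// (covariant_family_range cov).
  rewrite /component_similarity (lin_sum (rep_lin PiP _)) (bigD1 f) ?fu//=.
  rewrite -rep_mul// SS eqxx big1 ?addr0; first exact/fiberP/Fz.
  move=> e /andP[_ ef]; rewrite -rep_mul// SS eq_sym (negPf ef).
  exact: rep0.
Qed.

Lemma restriction_self_similar : exists psi (pi : CE -> H -> H),
  [/\ similarity F psi, associated_rep F psi pi &
      self_similar a pi (fun g => Pi (U g))].
Proof.
have [h [[hP hp hs] _]] := gc_universal CE ge_graph_relations.
exists component_similarity, (fun b => Pi (h b)).
split; first exact: component_similarityP.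
  split=> [|u v x /fiberP Fx|e x /fiberP Fx]; first exact: star_hom_rep.
    rewrite hp -Fx -rep_mul// ge_P_mul; case: eqP => [->//|_]; exact: rep0.
  rewrite hs; split=> [|f fe].
    by apply: fiber_mem_mul; exact: covariant_family_range cov _.
  rewrite /component_similarity -rep_mul// SS; case: eqP => [->//|_].
  exact: rep0.
move=> g e eg x /=; have [_ _ _ rel] := cov.
by rewrite !hs -!rep_mul// rel.
Qed.

End CovariantToSelfSimilar.

Theorem proposition5p7 (R : realType) (E : digraph) (p : nat)
    (G : groupoid (E0 E)) (a : self_similar_action G)
    (X : cstar_GE R a) (CE : graph_cstar R E) (H : hilbert R)
    (E_no_sources : no_sources E) (p_ge2 : (2 <= p)%N)
    (E_regular : forall u : E0 E, #|[set e : E1 E | rg e == u]%SET| = p) :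
  (forall (F : E0 E -> set H) (psi : E0 E -> H -> E1 E -> H)
      (pi : CE -> H -> H) (rho : G -> H -> H),
    hilbert_bundle F ->
    (forall u, infinite_dimensional (F u)) ->
    similarity F psi ->
    associated_rep F psi pi ->
    groupoid_rep F rho ->
    self_similar a pi rho <-> generate_rep X pi rho) /\
  (forall (F : E0 E -> set H) (rho : G -> H -> H),
    self_similar_rep a CE F rho <-> restricted_rep X F rho).
Proof.
split=> [F psi pi rho FP _ psiP piP rhoP|F rho].
  exact: self_similar_iff_generate FP psiP piP rhoP X.
split=> [[FP rhoP [psi [pi [psiP piP]]]]|[Pi [PiP Pnd FE rhoE]]].
  move=> /(self_similar_iff_generate FP psiP piP rhoP X)[Pi [PiP PiU _]].
  exists Pi; split=> // [|u|g x]; last by rewrite PiU.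
  - apply/seteqP; split=> // x _; apply: subset_closure.
    have [_ _ dec] := FP; have [f [Ff ->]] := dec x.
    exists #|E0 E|, (fun=> 1), (fun i => f (enum_val i)); split=> [i|].
      exists (ge_P X (enum_val i)), (f (enum_val i)).
      by rewrite /ge_P PiU (rho_id rhoP).
    under [RHS]eq_bigr do rewrite scale1r.
    by rewrite -big_enum_val.
  - apply/seteqP; split=> [x Fx|_ [x _ <-]].
      by exists x => //; rewrite /ge_P PiU (rho_id rhoP).
    by rewrite /ge_P PiU; exact: rho_id_mem FP rhoP _ _.
have -> : rho = fun g => Pi (ge_U X g) 
  by apply/funext => g; apply/funext => x; exact: rhoE.
split; [exact: fiber_bundle FE|exact: restriction_groupoid_rep|].
exact: restriction_self_similar.
Qed.
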